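(* If $\{a_1 \pmod{m_1}, \ldots, a_n \pmod{m_n}\}$ is a covering system with distinct moduli (i.e. $m_i \neq m_j$ whenever $i \neq j$) whose smallest modulus is $\min_i m_i = 5$, then its largest modulus satisfies $\max_i m_i \geq 108$.
   Context: For an integer $a$ and a positive integer $m$, the arithmetic progression $a \pmod{m}$ is the set $\{a+km : k \in \mathbb{Z}\}$, and $m$ is called its modulus. A covering system is a finite set of arithmetic progressions $\{a_1 \pmod{m_1}, \ldots, a_n \pmod{m_n}\}$ such that every integer belongs to at least one of them. *)

(* Defs.v *)
From mathcomp Require Import all_boot all_order all_algebra.
Set Implicit Arguments.
Unset Strict Implicit.
Unset Printing Implicit Defensive.
Import GRing.Theory.
Local Open Scope ring_scope.

Definition arith_prog (a : int) (m : nat) (x : int) : Prop :=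
  exists k : int, x = a + k * m%:Z.

(* A system is given as a family indexed by 'I_n.  Possible repetitions in
   the family are harmless here: they are excluded by distinct_moduli. *)
Definition covering_system (n : nat) (a : 'I_n -> int) (m : 'I_n -> nat)
    : Prop :=
  (forall i, (0 < m i)%N) /\
  (forall x : int, exists i, arith_prog (a i) (m i) x).

Definition distinct_moduli (n : nat) (m : 'I_n -> nat) : Prop :=
  forall i j, i <> j -> m i <> m j.

(* A predicate rather than \big[minn/_], since minn has no neutral element
   on nat. *)
Definition smallest_modulus (n : nat) (m : 'I_n -> nat) (d : nat) : Prop :=
  (exists i, m i = d) /\ (forall i, (d <= m i)%N).

(* Main.v *)
(* Suppose that a covering system has distinct moduli between 5 and 107.  If fewer
   than p of the moduli are multiples of the prime power p ^ k, an integer missed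
   by the others has p translates in distinct classes modulo p ^ k, and these few
   progressions cannot contain them all; hence such moduli can be dropped, and 33
   moduli dividing 2 ^ 5 * 3 ^ 2 * 5 * 7 remain.  The same translation argument
   replaces the multiples of 16 by coarser classes modulo 24 and 40.

   Let U be the set of integers missed by the moduli prime to 7 that are left (all
   of them divide 360).  By the Chinese remainder theorem U must be covered, for
   each residue s modulo 7, by the classes modulo d of those moduli 7 d whose class
   is s modulo 7.  The modulus 7 settles one residue and the ten other multiples of
   7 are shared by the remaining six; whatever the partition, this confines U to one
   of a few very small unions of classes.  Together with the moduli prime to 7
   these would cover four rows Z/72, namely the residues modulo 5 outside the class
   modulo 5; a branch and bound search up to symmetry shows that they cannot. *)

(* The six residues modulo 7 are restrictive because the progressions serving each of them must
   cover all of U: an element of U can be moved within its class modulo 360 to any residue modulo 7.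
   Six nonempty blocks formed from ten progressions include at least two singletons, and each
   singleton puts U in one class. Intersecting these with one block of at most two progressions
   leaves at most two small classes, whose centres can be taken in U itself, hence congruent modulo
   the number K that confines U. Counting grid cells from such a centre turns this into a fixed list
   of admissible classes, the multiples of K.

   The search is a weighing argument. The gains of the pieces of a covering add up to at least the
   number of cells left; the slack is the surplus of the sum of the upper bounds over that number,
   so no piece can fall short of its bound by more than the slack. The symmetries used are exchanges
   of branches in the trees of residues modulo 8 and modulo 9, and exchanges of equal rows. *)
From Stdlib Require Import NArith Classical.
From mathcomp Require Import zify.
Require Import Defs.
From mathcomp Require Import all_boot all_order all_algebra.

Set Implicit Arguments.
Unset Strict Implicit.
Unset Printing Implicit Defensive.

(** * Branch and bound search for a placement of residue classes *)

(* The virtual machine evaluates both arguments of [&&] and [||]; the checker is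
   written with [if] instead so that it stops early. *)
Fixpoint leqb (m n : nat) : bool :=
  match m, n with
  | 0, _ => true
  | _.+1, 0 => false
  | m'.+1, n'.+1 => leqb m' n'
  end.

Fixpoint hasb (T : Type) (p : T -> bool) (s : seq T) : bool :=
  if s is x :: s' then if p x then true else hasb p s' else false.

Fixpoint allb (T : Type) (p : T -> bool) (s : seq T) : bool :=
  if s is x :: s' then if p x then allb p s' else false else true.

Fixpoint allib (T : Type) (p : nat -> T -> bool) (i : nat) (s : seq T) : bool :=
  if s is x :: s' then if p i x then allib p i.+1 s' else false else true.

Fixpoint eqseqb (s t : seq nat) : bool :=
  match s, t with
  | [::], [::] => true
  | x :: s', y :: t' => if eqn x y then eqseqb s' t' else false
  | _, _ => false
  end.

Fixpoint addv (s t : seq nat) : seq nat :=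
  match s, t with
  | x :: s', y :: t' => x + y :: addv s' t'
  | [::], _ => t
  | _, [::] => s
  end.

(** Turns sums over the classes modulo [f.+1 * q] into sums over the classes modulo [q], so that
    each table of [class_sums] is obtained from a shorter one. *)
Fixpoint fold_chunks (f q : nat) (s : seq nat) : seq nat :=
  if f is f'.+1 then addv (take q s) (fold_chunks f' q (drop q s)) else s.

Definition moduli := [:: 72; 36; 24; 18; 12; 9; 8; 6; 4; 3; 2].

(* One list of sums over residue classes for each modulus in [moduli]. *)
Definition class_sums (s : seq nat) : seq (seq nat) :=
  let t36 := fold_chunks 1 36 s in
  let t24 := fold_chunks 2 24 s in
  let t18 := fold_chunks 1 18 t36 in
  let t12 := fold_chunks 1 12 t24 in
  let t9 := fold_chunks 1 9 t18 in
  let t8 := fold_chunks 2 8 t24 in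
  let t6 := fold_chunks 1 6 t12 in
  let t4 := fold_chunks 1 4 t8 in
  let t3 := fold_chunks 1 3 t6 in
  let t2 := fold_chunks 1 2 t4 in
  [:: s; t36; t24; t18; t12; t9; t8; t6; t4; t3; t2].

Arguments class_sums : simpl never.

(* A piece is a progression modulo a divisor m of 72 whose class is still to be
   chosen, in a grid of several rows of 72 cells.  It acts in all rows or in one
   row (a modulus 5 m); [Split], with m = 24, covers a class modulo 8 in one row
   and two thirds of it in the others.  The mask restricts the admissible
   classes, and [piece_two] stands for two interchangeable copies. *)
Variant scope := AllRows | OneRow | Split.

Record piece := Piece {
  piece_scope : scope;
  piece_idx : nat;
  piece_mask : option (seq bool);
  piece_two : bool }.

Definition piece_mod (e : piece) : nat := nth 1 moduli (piece_idx e).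

Definition allowed (e : piece) (a : nat) : bool :=
  if piece_mask e is Some b then nth false b a else true.

Definition hit (e : piece) (p : nat * nat) (r x : nat) : bool :=
  match piece_scope e with
  | AllRows => x %% piece_mod e == p.2
  | OneRow => (r == p.1) && (x %% piece_mod e == p.2)
  | Split => (x %% 8 == p.2 %% 8) && ((r == p.1) || (x %% 24 != p.2))
  end.

Definition shift24 (a d : nat) : nat :=
  let c := a + d in if leqb 24 c then c - 24 else c.

Fixpoint apply_mask (b : seq bool) (s : seq nat) : seq nat :=
  match b, s with
  | c :: b', x :: s' => (if c then x else 0) :: apply_mask b' s'
  | _, _ => [::]
  end.

Definition masked (e : piece) (s : seq nat) : seq nat :=
  if piece_mask e is Some b then apply_mask b s else s.

Definition total_sums (i : nat) (Ts : seq (seq (seq nat))) : seq nat :=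
  foldr addv [::] [seq nth [::] t i | t <- Ts].

Definition gains (e : piece) (Ts : seq (seq (seq nat))) : seq (seq nat) :=
  match piece_scope e with
  | AllRows => [:: masked e (total_sums (piece_idx e) Ts)]
  | OneRow => [seq masked e (nth [::] t (piece_idx e)) | t <- Ts]
  | Split =>
      let t := total_sums 2 Ts in
      (* The position of a [Split] piece is its exceptional class modulo 24. Rotations by 8 and 16
         read the two other classes in the same class modulo 8, which count in all rows. *)
      let u := addv (drop 8 t ++ take 8 t) (drop 16 t ++ take 16 t) in
      [seq addv u (nth [::] t' 2) | t' <- Ts]
  end.

Fixpoint max1 (m : nat) (s : seq nat) : nat :=
  if s is x :: s' then max1 (if leqb x m then m else x) s' else m.

Fixpoint max2 (m1 m2 : nat) (s : seq nat) : nat * nat :=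
  if s is x :: s' then
    if leqb x m2 then max2 m1 m2 s'
    else if leqb x m1 then max2 m1 x s' else max2 x m1 s'
  else (m1, m2).

(* In a pair (b, last), b bounds the gain of all copies of a piece and b - last
   that of all copies but one. *)
Definition best_gains (two : bool) (s : seq (seq nat)) : nat * nat :=
  if two then
    let m := foldl (fun m l => max2 m.1 m.2 l) (0, 0) s in (m.1 + m.2, m.2)
  else let m := foldl max1 0 s in (m, m).

(** Here [m] is the modulus minus one and [c] counts down to the next cell to clear, which avoids
    divisions. *)
Fixpoint clear_class (m : nat) (s : seq nat) (c : nat) : seq nat :=
  if s is x :: s' then
    if c is c'.+1 then x :: clear_class m s' c' else 0 :: clear_class m s' m
  else [::].

Fixpoint mapi (f : nat -> seq nat -> seq nat) (i : nat) (s : seq (seq nat)) :=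
  if s is x :: s' then f i x :: mapi f i.+1 s' else [::].

Definition place (e : piece) (p : nat * nat) (rows : seq (seq nat))
    : seq (seq nat) :=
  let m := (piece_mod e).-1 in
  match piece_scope e with
  | AllRows => [seq clear_class m r p.2 | r <- rows]
  | OneRow =>
      mapi (fun i r => if eqn i p.1 then clear_class m r p.2 else r) 0 rows
  | Split =>
      mapi (fun i r =>
        let r' := clear_class 23 (clear_class 23 r (shift24 p.2 8))
                    (shift24 p.2 16) in
        if eqn i p.1 then clear_class 23 r' p.2 else r') 0 rows
  end.

Definition update_sums (e : piece) (p : nat * nat) (rows : seq (seq nat))
    (Ts : seq (seq (seq nat))) : seq (seq (seq nat)) :=
  if piece_scope e is OneRow then
    set_nth [::] Ts p.1 (class_sums (nth [::] rows p.1))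
  else map class_sums rows.

Record swap := Swap {
  swap_perm : seq nat;
  swap_fixes : seq (seq bool);
  swap_decr : seq (seq bool) }.

(** Lexicographic order on the Chinese remainder coordinates modulo the 2-part and the 3-part of
    [m]. It serves as the measure that decreases when a flagged class is replaced by its image. *)
Definition residue_key (m a : nat) : nat := a %% gcdn m 8 * 9 + a %% gcdn m 9.

(* Translating the class a modulo m by t and the class b by - t permutes the
   residue classes of every modulus in [moduli], for suitable t.  A class is
   flagged when the swap sends it to a class with a smaller key: such a class
   need not be tried. *)
Definition exchange (m a b t : nat) : swap :=
  let f x := if x %% m == a then (x + t) %% 72
             else if x %% m == b then (x + (72 - t)) %% 72 else x in
  let s := map f (iota 0 72) in
  Swap s [seq [seq nth 0 s c %% q == c | c <- iota 0 q] | q <- moduli]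
    [seq [seq residue_key q (nth 0 s c %% q) < residue_key q c | c <- iota 0 q]
       | q <- moduli].

(** Each translation is a multiple of 9 for a power of 2 and of 8 for a power of 3, so that only one
    Chinese remainder coordinate moves. Every swap exchanges two sibling branches: classes modulo 2,
    4, 8, 3 or 9 inside a common class one level up. *)
Definition swaps : seq swap :=
  [:: exchange 2 0 1 9; exchange 4 0 2 18; exchange 4 1 3 18;
      exchange 8 0 4 36; exchange 8 1 5 36; exchange 8 2 6 36;
      exchange 8 3 7 36; exchange 3 0 1 64; exchange 3 1 2 64;
      exchange 3 0 2 8] ++
  flatten [seq [:: exchange 9 c (c + 3) 48; exchange 9 (c + 3) (c + 6) 48;
                   exchange 9 c (c + 6) 24] | c <- [:: 0; 1; 2]].

Fixpoint count_geq (thr : nat) (s : seq nat) (c : N) : N :=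
  if s is x :: s' then
    count_geq thr s' (if leqb thr x then N.succ c else c)
  else c.

(** The minimum 1 excludes positions without gain: a copy placed there can be moved to a best
    position instead. *)
Definition threshold (slack last : nat) : nat :=
  if last - slack is t.+1 then t.+1 else 1.

Definition piece_info := (piece * seq (seq nat) * (nat * nat))%type.

(* Branching heuristic: few viable positions relative to the bound. *)
Fixpoint choose (slack : nat) (l : seq piece_info) (i besti : nat)
    (num den : N) : nat :=
  if l is (e, g, (b, last)) :: l' then
    if eqn b 0 then choose slack l' i.+1 besti num den else
    let n := foldl (fun c s => count_geq (threshold slack last) s c) 0%num g in
    let n := if piece_two e then N.double n else n in
    (* The score is the fraction n / (b + 1)^2, compared by cross multiplication and starting from
       1/0 as infinity. A forced piece, with one viable position, gets score 0. *)
    let n := if n is Npos xH then N0 else n in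
    let b1 := N.of_nat b.+1 in
    let b2 := N.mul b1 b1 in
    if N.ltb (N.mul n den) (N.mul num b2) then choose slack l' i.+1 i n b2
    else choose slack l' i.+1 besti num den
  else besti.

Definition remaining (e : piece) : seq piece :=
  if piece_two e then
    [:: Piece (piece_scope e) (piece_idx e) (piece_mask e) false]
  else [::].

(* olds are upper bounds for the gains of the pieces, exceeding the weight left to
   cover by [excess]; the result is the excess of the sharper bounds in l, and
   [None] when these no longer suffice. *)
Fixpoint tighten (excess : nat) (olds : seq nat) (l : seq piece_info)
    : option nat :=
  match olds, l with
  | old :: olds', (_, _, (b, _)) :: l' =>
      if leqb old (excess + b) then tighten (excess + b - old) olds' l' else None
  | _, _ => Some excess
  end.

(** Equal rows are interchangeable, so only the first of them is tried. *)
Definition new_row (rows : seq (seq nat)) (g : nat) : bool :=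
  ~~ hasb (eqseqb (nth [::] rows g)) (take g rows).

Definition flagged (sws : seq swap) (i a : nat) : bool :=
  hasb (fun s => nth false (nth [::] (swap_decr s) i) a) sws.

Definition stabilizer (sws : seq swap) (i a : nat) : seq swap :=
  filter (fun s => nth false (nth [::] (swap_fixes s) i) a) sws.

Definition info_of (Ts : seq (seq (seq nat))) (e : piece) : piece_info :=
  let g := gains e Ts in (e, g, best_gains (piece_two e) g).

Definition bound_of (x : piece_info) : nat := x.2.1.

Definition old_remaining (e : piece) (b last : nat) : seq nat :=
  if piece_two e then [:: b - last] else [::].

(* Depth-first search for a placement of the pieces els that covers every nonzero
   entry.  In a covering the other pieces gain at most their bounds, so some copy
   of the selected piece gains at least [last - slack]. *)
Fixpoint refute (fuel : nat) (rows : seq (seq nat)) (Ts : seq (seq (seq nat)))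
    (sws : seq swap) (els : seq piece) (olds : seq nat) (excess : nat) : bool :=
  if fuel is f.+1 then
    let info := map (info_of Ts) els in
    if tighten excess olds info is Some slack then
      let i := choose slack info 0 0 1%num 0%num in
      if drop i info is (e, g, (b, last)) :: _ then
        if eqn b 0 then false else
        let thr := threshold slack last in
        let els' := take i els ++ remaining e ++ drop i.+1 els in
        let bs := map bound_of info in
        let olds' := take i bs ++ old_remaining e b last ++ drop i.+1 bs in
        allib (fun r gs =>
          if new_row rows r then
            allib (fun a x =>
              if leqb thr x then
                if flagged sws (piece_idx e) a then true
                else let rows' := place e (r, a) rows in
                     refute f rows' (update_sums e (r, a) rows' Ts)
                       (stabilizer sws (piece_idx e) a) els'
                       (* The sum of the bounds drops by [last] and the weight left by [x]. Since
                          [x] reaches the threshold, the subtraction is not truncated. *)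
                       olds' (slack + x - last)
              else true) 0 gs
          else true) 0 g
      else false
    else true
  else false.

(** The mask keeps the multiples of [K]: the grid is counted from a point of the class modulo [K]
    that contains U. *)
Definition mk_piece (k : scope) (K m : nat) (two : bool) : piece :=
  Piece k (index m moduli)
    (if K == 1 then None else Some [seq a %% K == 0 | a <- iota 0 m]) two.

Definition full_rows : seq (seq nat) := nseq 4 (nseq 72 1).

Definition compatible (e : piece) (s : swap) : bool :=
  all (fun a => allowed e a ==> allowed e (nth 0 (swap_perm s) a %% piece_mod e))
    (iota 0 (piece_mod e)).

Definition refuted (els : seq piece) : bool :=
  let Ts := map class_sums full_rows in
  let bs := map (fun e => bound_of (info_of Ts e)) els in
  (* 288 is the number 4 * 72 of cells. Each level places one copy and there are at most 20 copies,
     so 40 is enough fuel. Swaps that could send an admissible class to a masked one are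
     discarded. *)
  refute 40 full_rows Ts [seq s <- swaps | all (compatible^~ s) els] els bs
    (foldr addn 0 bs - 288).

(** * Class sums and gains *)

Lemma leqbE m n : leqb m n = (m <= n).
Proof. by elim: m n => [|m IH] [|n] //=; rewrite IH ltnS. Qed.

Lemma hasbE (T : Type) (p : pred T) s : hasb p s = has p s.
Proof. by elim: s => //= x s ->; case: (p x). Qed.

Lemma allbE (T : Type) (p : pred T) s : allb p s = all p s.
Proof. by elim: s => //= x s ->; case: (p x). Qed.

Lemma allibP (T : Type) (x0 : T) (p : nat -> T -> bool) i s :
  reflect (forall k, k < size s -> p (i + k) (nth x0 s k)) (allib p i s).
Proof.
elim: s i => [|x s IH] i /=; first by constructor.
case px: (p i x); last first.
  by constructor=> /(_ 0 isT) /=; rewrite addn0 px.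
apply: (iffP (IH _)) => [h [|k] /= lt_k|h k lt_k].
- by rewrite addn0.
- by rewrite addnS -addSn; apply: h.
- by rewrite addSn -addnS; apply: (h k.+1).
Qed.

Lemma eqseqbE s t : eqseqb s t = (s == t).
Proof.
elim: s t => [|x s IH] [|y t] //=; rewrite eqseq_cons -IH.
by rewrite eqnE; case: (x == y).
Qed.

Lemma nth_addv s t i : nth 0 (addv s t) i = nth 0 s i + nth 0 t i.
Proof.
elim: s t i => [|x s IH] [|y t] [|i] //=; rewrite ?nth_nil ?addn0 //.
Qed.

Lemma size_addv s t : size (addv s t) = maxn (size s) (size t).
Proof.
elim: s t => [|x s IH] [|y t]; rewrite /= ?max0n ?maxn0 // IH.
by rewrite maxnSS.
Qed.

Lemma nth_fold_chunks f q s a : a < q ->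
  nth 0 (fold_chunks f q s) a = \sum_(j < f.+1) nth 0 s (a + j * q).
Proof.
move=> lt_aq; elim: f s => [|f IH] s /=; first by rewrite big_ord1 mul0n addn0.
rewrite nth_addv nth_take // IH [RHS]big_ord_recl mul0n addn0; congr addn.
apply: eq_bigr => j _; rewrite nth_drop lift0 mulSn; congr nth; lia.
Qed.

Lemma size_fold_chunks f q s : size s = f.+1 * q ->
  size (fold_chunks f q s) = q.
Proof.
elim: f s => [|f IH] s /=; first by rewrite mul1n.
rewrite mulSn => sz_s; rewrite size_addv size_take IH; last first.
  by rewrite size_drop sz_s; lia.
by rewrite sz_s; case: ifP; lia.
Qed.

Definition class_weight (w : nat -> nat) (m a : nat) : nat :=
  \sum_(0 <= x < 72) w x * (x %% m == a).

Lemma class_weight_fold w f q t : 0 < q ->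
  (forall a, a < f.+1 * q -> nth 0 t a = class_weight w (f.+1 * q) a) ->
  forall a, a < q -> nth 0 (fold_chunks f q t) a = class_weight w q a.
Proof.
move=> q_gt0 tE a lt_aq; rewrite nth_fold_chunks //.
under eq_bigr => j _.
  rewrite tE; first over.
  by rewrite (leq_trans (_ : _ < j.+1 * q)) ?leq_mul2r ?ltn_ord ?orbT // mulSn ltn_add2r.
rewrite /class_weight exchange_big /=; apply: eq_bigr => x _.
rewrite -big_distrr /=; congr (_ * _).
have [xa|xna] := eqVneq (x %% q) a; last first.
  rewrite big1 // => j _; apply/eqP; rewrite eqb0; apply: contra xna => /eqP h.
  have := modn_dvdm x (dvdn_mull f.+1 (dvdnn q)); rewrite h.
  by rewrite addnC modnMDl modn_small // => ->.
have lt_j : (x %% (f.+1 * q)) %/ q < f.+1.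
  by rewrite ltn_divLR // ltn_mod muln_gt0 q_gt0.
rewrite (bigD1 (Ordinal lt_j)) //= big1 => [|j ne_j].
  have := divn_eq (x %% (f.+1 * q)) q.
  rewrite modn_dvdm ?dvdn_mull // xa addnC => {1}->.
  by rewrite eqxx addn0.
apply/eqP; rewrite eqb0; apply: contra ne_j => /eqP h.
by apply/eqP/val_inj; rewrite /= h addnC divnMDl // divn_small ?addn0.
Qed.

Lemma class_weight_self w a : a < 72 -> class_weight w 72 a = w a.
Proof.
move=> lt_a; rewrite /class_weight (bigD1_seq a) ?mem_index_iota ?iota_uniq //=.
rewrite modn_small // eqxx muln1 big_seq_cond big1 ?addn0 // => x.
rewrite mem_index_iota => /andP[/andP[_ lt_x] /negbTE xa].
by rewrite modn_small // xa muln0.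
Qed.

Lemma class_sumsP s i a : size s = 72 -> i < 11 -> a < nth 1 moduli i ->
  nth 0 (nth [::] (class_sums s) i) a = class_weight (nth 0 s) (nth 1 moduli i) a.
Proof.
move=> sz; set w := nth 0 s.
have t72 a' : a' < 72 -> nth 0 s a' = class_weight w 72 a' by move=> /class_weight_self->.
have t36 := @class_weight_fold w 1 36 s isT t72.
have t24 := @class_weight_fold w 2 24 s isT t72.
have t18 := @class_weight_fold w 1 18 _ isT t36.
have t12 := @class_weight_fold w 1 12 _ isT t24.
have t9 := @class_weight_fold w 1 9 _ isT t18.
have t8 := @class_weight_fold w 2 8 _ isT t24.
have t6 := @class_weight_fold w 1 6 _ isT t12.
have t4 := @class_weight_fold w 1 4 _ isT t8.
have t3 := @class_weight_fold w 1 3 _ isT t6.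
have t2 := @class_weight_fold w 1 2 _ isT t4.
by do 11?[case: i => [|i]] => // _ lt_a; auto.
Qed.

Lemma size_class_sums s i : size s = 72 -> i < 11 ->
  size (nth [::] (class_sums s) i) = nth 1 moduli i.
Proof.
move=> sz.
have s36 := @size_fold_chunks 1 36 s sz.
have s24 := @size_fold_chunks 2 24 s sz.
have s18 := @size_fold_chunks 1 18 _ s36.
have s12 := @size_fold_chunks 1 12 _ s24.
have s9 := @size_fold_chunks 1 9 _ s18.
have s8 := @size_fold_chunks 2 8 _ s24.
have s6 := @size_fold_chunks 1 6 _ s12.
have s4 := @size_fold_chunks 1 4 _ s8.
have s3 := @size_fold_chunks 1 3 _ s6.
have s2 := @size_fold_chunks 1 2 _ s4.
by do 11?[case: i => [|i]].
Qed.

(** * Weights of subsets of the grid, and gains as weights *)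

Definition entry (rows : seq (seq nat)) (r x : nat) : nat := nth 0 (nth [::] rows r) x.

Definition rows_ok (rows : seq (seq nat)) : bool := all (fun r => size r == 72) rows.

Lemma nth_sum_rows rows x :
  nth 0 (foldr addv [::] rows) x = \sum_(0 <= r < size rows) entry rows r x.
Proof.
elim: rows => [|s rows IH] /=; first by rewrite nth_nil big_geq.
by rewrite nth_addv IH big_nat_recl.
Qed.

Definition weight (rows : seq (seq nat)) (S : nat -> nat -> bool) : nat :=
  \sum_(0 <= r < size rows) \sum_(0 <= x < 72) entry rows r x * S r x.

Lemma weight_le rows (S T : nat -> nat -> bool) :
  (forall r x, r < size rows -> x < 72 -> entry rows r x != 0 -> S r x -> T r x) ->
  weight rows S <= weight rows T.
Proof.
move=> sub; rewrite /weight !big_nat; apply: leq_sum => r /= lt_r.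
rewrite !big_nat; apply: leq_sum => x /= lt_x.
have [->|nz] := eqVneq (entry rows r x) 0; first by [].
by rewrite leq_mul2l; case Srx: (S r x); rewrite ?orbT // (sub r x) ?orbT.
Qed.

Lemma weightU rows (S T : nat -> nat -> bool) :
  weight rows (fun r x => S r x || T r x) <= weight rows S + weight rows T.
Proof.
rewrite /weight -big_split /=; apply: leq_sum => r _.
rewrite -big_split /=; apply: leq_sum => x _.
by rewrite -mulnDr leq_mul2l; case: (S r x); case: (T r x); rewrite ?orbT.
Qed.

Lemma rows_okP rows : reflect (forall r, r < size rows -> size (nth [::] rows r) = 72)
  (rows_ok rows).
Proof. by apply: (iffP (all_nthP [::])) => h r /h /eqP. Qed.

Lemma total_sumsP rows i a : rows_ok rows -> i < 11 -> a < nth 1 moduli i ->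
  nth 0 (total_sums i (map class_sums rows)) a =
  weight rows (fun _ x => x %% nth 1 moduli i == a).
Proof.
move=> /rows_okP ok lt_i lt_a; rewrite nth_sum_rows !size_map /weight !big_nat.
apply: eq_bigr => r /= lt_r.
by rewrite /entry (nth_map [::]) ?size_map // (nth_map [::]) // class_sumsP ?ok.
Qed.

Lemma size_total_sums rows i : rows != [::] -> rows_ok rows -> i < 11 ->
  size (total_sums i (map class_sums rows)) = nth 1 moduli i.
Proof.
rewrite /total_sums; elim: rows => [|s rows IH] //= _ /andP[/eqP sz ok] lt_i.
rewrite size_addv size_class_sums //.
by case: rows IH ok => [|s' rows] IH ok; rewrite ?maxn0 // IH // maxnn.
Qed.

Lemma weight_onerow rows m a g : g < size rows ->
  weight rows (fun r x => (r == g) && (x %% m == a)) = class_weight (nth 0 (nth [::] rows g)) m a.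
Proof.
move=> lt_g; rewrite /weight (bigD1_seq g) ?mem_index_iota ?iota_uniq //=.
rewrite [X in _ + X]big1 ?addn0 => [|r /negbTE ne].
  by apply: eq_bigr => x _; rewrite eqxx.
by rewrite big1 // => x _; rewrite ne muln0.
Qed.

Definition piece_ok (e : piece) : bool :=
  (piece_idx e < 11) &&
  (if piece_scope e is Split then (piece_idx e == 2) && ~~ isSome (piece_mask e)
   else true).

Definition position_ok (n : nat) (e : piece) (p : nat * nat) : bool :=
  [&& (if piece_scope e is AllRows then p.1 == 0 else p.1 < n),
      p.2 < piece_mod e & allowed e p.2].

Lemma nth_apply_mask b s a :
  nth 0 (apply_mask b s) a = if nth false b a then nth 0 s a else 0.
Proof.
elim: b s a => [|c b IH] [|x s] [|a] //=; rewrite ?nth_nil ?if_same //.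
Qed.

Lemma nth_masked e s a : allowed e a -> nth 0 (masked e s) a = nth 0 s a.
Proof.
by rewrite /allowed /masked; case: (piece_mask e) => // b h; rewrite nth_apply_mask h.
Qed.

Lemma nth_rot24 t d a : size t = 24 -> d < 24 -> a < 24 ->
  nth 0 (drop d t ++ take d t) a = nth 0 t (shift24 a d).
Proof.
move=> sz lt_d lt_a; rewrite nth_cat size_drop sz nth_drop /shift24 leqbE.
case: ltnP => h; case: leqP => h'; try lia; first by rewrite addnC.
rewrite nth_take; last lia.
congr nth; lia.
Qed.

Lemma all_iotaP n (P : pred nat) : all P (iota 0 n) -> forall a, a < n -> P a.
Proof. by move=> /allP h a lt_a; apply: h; rewrite mem_iota. Qed.

(** Writes the region of a [Split] piece as a disjoint union of classes modulo 24, so that its gain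
    is a sum and its placement clears them one at a time. Everything depends on [x %% 24] only,
    which leaves a finite check. *)
Lemma split_pieces b a x : a < 24 ->
  (x %% 8 == a %% 8) && (b || (x %% 24 != a)) =
  (x %% 24 == shift24 a 8) + (x %% 24 == shift24 a 16) + b && (x %% 24 == a) :> nat.
Proof.
move=> lt_a; rewrite -(@modn_dvdm 24 x 8) //.
have: x %% 24 < 24 by rewrite ltn_mod.
move: (x %% 24) => y lt_y.
have: all (fun y => all (fun a => all (fun b : bool =>
   (y %% 8 == a %% 8) && (b || (y != a)) ==
  (y == shift24 a 8) + (y == shift24 a 16) + (b && (y == a)) :> nat) [:: true; false])
   (iota 0 24)) (iota 0 24) by vm_compute.
move=> /all_iotaP /(_ y lt_y) /all_iotaP /(_ a lt_a) /= /and3P[/eqP ht /eqP hf _].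
by case: b.
Qed.

Lemma gainsP (rows : seq (seq nat)) e p : rows != [::] -> rows_ok rows ->
  piece_ok e -> position_ok (size rows) e p ->
  nth 0 (nth [::] (gains e (map class_sums rows)) p.1) p.2 = weight rows (hit e p).
Proof.
move=> nz ok eok /and3P[lt_g lt_a al].
have row_sz := rows_okP rows ok.
have idx_lt : piece_idx e < 11 by case/andP: eok.
rewrite /gains /hit; case se: (piece_scope e) eok lt_g => eok lt_g.
- by rewrite (eqP lt_g) /= nth_masked // total_sumsP.
- rewrite (nth_map [::]) ?size_map // (nth_map [::]) // nth_masked //.
  by rewrite class_sumsP ?row_sz // -(weight_onerow _ _ lt_g).
move: eok; rewrite /piece_ok se => /and3P[_ /eqP idx2 _].
have lt_a24 : p.2 < 24 by move: lt_a; rewrite /piece_mod idx2.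
have sh d : d < 24 -> shift24 p.2 d < 24.
  by rewrite /shift24 leqbE; case: (leqP 24 (p.2 + d)) => *; lia.
rewrite (nth_map [::]) ?size_map // (nth_map [::]) //.
rewrite nth_addv [X in X + _]nth_addv !nth_rot24 ?size_total_sums //.
rewrite !total_sumsP ?sh // class_sumsP ?row_sz //.
rewrite -(weight_onerow _ _ lt_g) /weight -!big_split /=.
apply: eq_bigr => r _; rewrite -!big_split /=; apply: eq_bigr => x _.
by rewrite -!mulnDr split_pieces.
Qed.

Lemma nth_clear_class m s c x : c <= m ->
  nth 0 (clear_class m s c) x = if x == c %[mod m.+1] then 0 else nth 0 s x.
Proof.
elim: s c x => [|y s IH] c x le_c /=; first by rewrite !nth_nil if_same.
case: c le_c => [|c] le_c; case: x => [|x] //=.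
- rewrite IH //; congr (if _ then _ else _).
  by rewrite -(eqn_modDr 1) !addn1 modnn mod0n.
- by rewrite mod0n modn_small.
- by rewrite IH ?(ltnW le_c) // -(eqn_modDr 1) !addn1.
Qed.

Lemma size_clear_class m s c : size (clear_class m s c) = size s.
Proof. by elim: s c => [|y s IH] [|c] //=; rewrite IH. Qed.

Lemma size_mapi f i s : size (mapi f i s) = size s.
Proof. by elim: s i => //= x s IH i; rewrite IH. Qed.

Lemma nth_mapi f i s r : r < size s ->
  nth [::] (mapi f i s) r = f (i + r) (nth [::] s r).
Proof.
by elim: s i r => // x s IH i [|r] /= lt_r; rewrite ?addn0 // IH // addnS.
Qed.

Lemma size_place e p rows : size (place e p rows) = size rows.
Proof. by rewrite /place; case: piece_scope; rewrite ?size_map ?size_mapi. Qed.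

Lemma place_ok e p rows : rows_ok rows -> rows_ok (place e p rows).
Proof.
move=> /rows_okP ok; apply/rows_okP => r; rewrite size_place => lt_r.
rewrite /place; case: piece_scope; rewrite ?(nth_map [::]) ?nth_mapi //.
- by rewrite size_clear_class ok.
- by case: ifP => _; rewrite ?size_clear_class ok.
- by case: ifP => _; rewrite ?size_clear_class ok.
Qed.

Lemma placeP e p rows r x : piece_ok e -> position_ok (size rows) e p ->
  r < size rows ->
  entry (place e p rows) r x = if hit e p r x then 0 else entry rows r x.
Proof.
move=> eok /and3P[lt_g lt_a _] lt_r.
have m_gt0 : 0 < piece_mod e by apply: leq_ltn_trans lt_a.
have mE y : (y == p.2 %[mod (piece_mod e).-1.+1]) = (y %% piece_mod e == p.2).
  by rewrite prednK // (modn_small lt_a).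
rewrite /entry /place /hit; case se: (piece_scope e) eok lt_g => eok lt_g.
- by rewrite (nth_map [::]) // nth_clear_class ?mE // -ltnS prednK.
- rewrite nth_mapi // add0n eqnE; case: (r =P p.1) => //= _.
  by rewrite nth_clear_class ?mE // -ltnS prednK.
move: eok; rewrite /piece_ok se => /and3P[_ /eqP idx2 _].
have lt_a24 : p.2 < 24 by move: lt_a; rewrite /piece_mod idx2.
have sh d : d < 24 -> shift24 p.2 d < 24.
  by rewrite /shift24 leqbE; case: (leqP 24 (p.2 + d)) => *; lia.
have := split_pieces (r == p.1) x lt_a24.
rewrite nth_mapi // add0n eqnE.
rewrite (fun_if (fun s => nth 0 s x)) !nth_clear_class -1?ltnS ?sh //.
rewrite (modn_small lt_a24) !(modn_small (sh _ _)) //.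
case: (r == p.1); case: (_ && _); case: (x %% 24 == p.2);
  case: (x %% 24 == _); case: (x %% 24 == _) => //=.
Qed.

Lemma max1_spec m s : m <= max1 m s /\ (forall u, u \in s -> u <= max1 m s) /\
  (max1 m s = m \/ max1 m s \in s).
Proof.
elim: s m => [|x s IH] m /=; first by split=> //; split=> //; left.
have [h1 [h2 h3]] := IH (if leqb x m then m else x).
have le_m : m <= (if leqb x m then m else x) by rewrite leqbE; case: (leqP x m) => ?; lia.
have le_x : x <= (if leqb x m then m else x) by rewrite leqbE; case: (leqP x m) => ?; lia.
split; first exact: leq_trans h1.
split=> [u|]; first by rewrite inE => /predU1P[->|/h2] //; apply: leq_trans h1.
case: h3 => [->|h3]; last by right; rewrite inE h3 orbT.
by case: leqb; [left|right; rewrite inE eqxx].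
Qed.

Lemma foldl_max1 m s : foldl max1 m s = max1 m (flatten s).
Proof.
have max1_cat s1 s2 m' : max1 m' (s1 ++ s2) = max1 (max1 m' s1) s2.
  by elim: s1 m' => //=.
by elim: s m => //= l s IH m; rewrite IH max1_cat.
Qed.

Lemma foldl_max2 m s : foldl (fun m l => max2 m.1 m.2 l) m s = max2 m.1 m.2 (flatten s).
Proof.
have max2_cat s1 s2 a b : max2 a b (s1 ++ s2) =
    max2 (max2 a b s1).1 (max2 a b s1).2 s2.
  by elim: s1 a b => //= x s1 IH a b; do 2?case: ifP => _; rewrite IH.
by elim: s m => [[a b]|l s IH m] //=; rewrite IH max2_cat.
Qed.

(** Two copies at different positions may have equal gains, so a pair is a subsequence of length 2
    rather than two distinct values. The clauses with [m1] and [m2] account for values already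
    read. *)
Definition max2_inv m1 m2 (s : seq nat) (M : nat * nat) : Prop :=
  [/\ M.2 <= M.1, m1 <= M.1 /\ m1 + m2 <= M.1 + M.2,
      forall u, u \in s -> u <= M.1 /\ u + m1 <= M.1 + M.2,
      forall u v, subseq [:: u; v] s -> u + v <= M.1 + M.2
    & M.1 = m1 \/ M.1 \in s].

Lemma max2_spec m1 m2 s : m2 <= m1 -> max2_inv m1 m2 s (max2 m1 m2 s).
Proof.
elim: s m1 m2 => [|x s IH] m1 m2 le_m; first by split=> //; left.
have step a b : b <= a -> m1 <= a -> x <= a -> m1 + m2 <= a + b -> x + m1 <= a + b ->
    a = m1 \/ a = x -> max2_inv m1 m2 (x :: s) (max2 a b s).
  move=> le_ba le_1 le_x le_s le_xs ax; have [h1 [h2 h3] h4 h5 h6] := IH a b le_ba.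
  split=> //; first by lia.
  - move=> u; rewrite inE => /predU1P[->|/h4]; lia.
  - move=> u v; rewrite [subseq _ _]/=; case: (u =P x) => [->|_]; last exact: h5.
    by rewrite sub1seq => /h4; lia.
  - case: h6 => [->|h6]; last by right; rewrite inE h6 orbT.
    by case: ax => ->; [left|right; rewrite inE eqxx].
rewrite /= !leqbE; case: (leqP x m2) => h; last case: (leqP x m1) => h'.
- by apply: step; try lia; left.
- by apply: step; try lia; left.
- by apply: step; try lia; right.
Qed.

Lemma mem_flatten_nth (s : seq (seq nat)) g a : a < size (nth [::] s g) ->
  nth 0 (nth [::] s g) a \in flatten s.
Proof.
move=> lt_a; apply/flattenP; exists (nth [::] s g); last exact: mem_nth.
by apply: mem_nth; rewrite ltnNge; apply: contraL lt_a => /(nth_default [::])->.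
Qed.

Lemma subseq_pair (s : seq nat) a b : a < b < size s ->
  subseq [:: nth 0 s a; nth 0 s b] s.
Proof.
elim: s a b => [|x s IH] [|a] [|b] //=; rewrite !ltnS ?andbF ?eqxx //.
  by move=> lt_b; rewrite sub1seq mem_nth.
by move=> h; case: eqP => _; last exact: IH; rewrite sub1seq mem_nth //; case/andP: h.
Qed.

Lemma subseq_flatten (s : seq (seq nat)) g a h b :
  (g < h) || ((g == h) && (a < b)) ->
  a < size (nth [::] s g) -> b < size (nth [::] s h) ->
  subseq [:: nth 0 (nth [::] s g) a; nth 0 (nth [::] s h) b] (flatten s).
Proof.
elim: s g h => [|l s IH] g h; first by rewrite nth_nil.
case: g h => [|g] [|h] //=.
- move=> lt_ab _ lt_b; apply: subseq_trans (prefix_subseq l (flatten s)).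
  by apply: subseq_pair; rewrite lt_ab.
- move=> _ lt_a lt_b; rewrite -[[:: _; _]]cat1s cat_subseq // sub1seq ?mem_nth //.
  exact: mem_flatten_nth.
rewrite ltnS eqSS => lt lt_a lt_b; apply: subseq_trans (suffix_subseq l (flatten s)).
exact: IH.
Qed.

(** * Coverings by pieces and bounds on their gains *)

Section Cover.
Variable n : nat.

Definition hits (els : seq piece) (ps : seq (seq (nat * nat))) (r x : nat) : bool :=
  has (fun ep => has (fun p => hit ep.1 p r x) ep.2) (zip els ps).

Definition choice_ok (e : piece) (l : seq (nat * nat)) : bool :=
  (size l == (piece_two e).+1) && all (position_ok n e) l.

Definition coverable (V : nat -> nat -> bool) (els : seq piece) : Prop :=
  exists ps, [/\ size ps = size els,
                 all (fun ep => choice_ok ep.1 ep.2) (zip els ps)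
               & forall r x, r < n -> x < 72 -> V r x -> hits els ps r x].

End Cover.

Lemma hits_cat els1 els2 ps1 ps2 r x : size els1 = size ps1 ->
  hits (els1 ++ els2) (ps1 ++ ps2) r x = hits els1 ps1 r x || hits els2 ps2 r x.
Proof. by move=> sz; rewrite /hits zip_cat // has_cat. Qed.

Definition gains_of (rows : seq (seq nat)) (e : piece) :=
  gains e (map class_sums rows).

Definition listed (rows : seq (seq nat)) e (p : nat * nat) :=
  nth 0 (nth [::] (gains_of rows e) p.1) p.2.

Section Bounds.
Variable rows : seq (seq nat).
Lemma listed_le e p two : listed rows e p <= (best_gains two (gains_of rows e)).1.
Proof.
rewrite /listed; set l := nth [::] _ p.1.
case: (ltnP p.2 (size l)) => [lt|ge]; last by rewrite nth_default.
have mem : nth 0 l p.2 \in _ := mem_flatten_nth lt.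
rewrite /best_gains; case: two => /=.
  rewrite foldl_max2 /=; have [_ _ h _ _] := @max2_spec 0 0 (flatten (gains_of rows e)) isT.
  by have := h _ mem; lia.
by rewrite foldl_max1; have [_ [h _]] := max1_spec 0 (flatten (gains_of rows e)); apply: h.
Qed.

Lemma listed_pair e p q : p != q ->
  listed rows e p + listed rows e q <= (best_gains true (gains_of rows e)).1.
Proof.
(* Zero gains are set apart because such a position may lie outside the lists, where [nth] returns
   its default. *)
have small p' q' : listed rows e q' = 0 ->
    listed rows e p' + listed rows e q' <= (best_gains true (gains_of rows e)).1.
  by move=> ->; rewrite addn0; apply: listed_le.
have [/small-> //|nzq] := eqVneq (listed rows e q) 0.
have [/small h|nzp ne] := eqVneq (listed rows e p) 0; first by rewrite addnC h.
have lt p' : listed rows e p' != 0 -> p'.2 < size (nth [::] (gains_of rows e) p'.1).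
  by apply: contraR; rewrite -leqNgt /listed => /(nth_default 0)->.
have [_ _ _ h _] := @max2_spec 0 0 (flatten (gains_of rows e)) isT.
rewrite /best_gains foldl_max2 /=.
have: [|| (p.1 < q.1) || (p.1 == q.1) && (p.2 < q.2) |
         (q.1 < p.1) || (q.1 == p.1) && (q.2 < p.2)].
  case: p q ne {nzp nzq} => [a b] [c d] /=; rewrite xpair_eqE.
  by case: (ltngtP a c); case: (ltngtP b d).
case/orP => o; last rewrite addnC; apply: h.
  exact: subseq_flatten o (lt _ nzp) (lt _ nzq).
exact: subseq_flatten o (lt _ nzq) (lt _ nzp).
Qed.

Lemma best_last e two (B := best_gains two (gains_of rows e)) :
  B.1 != 0 -> exists p, listed rows e p != 0 /\ B.2 <= listed rows e p.
Proof.
have inG u : u \in flatten (gains_of rows e) -> exists p, listed rows e p = u.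
  case/flattenP => l /(nthP [::])[g _ <-] /(nthP 0)[a _ <-].
  by exists (g, a).
rewrite {}/B /best_gains; case: two => /=.
  rewrite foldl_max2 /=.
  have [h1 _ _ _ h2] := @max2_spec 0 0 (flatten (gains_of rows e)) isT.
  move=> nz; case: h2 => [z|/inG[p pE]]; first by move: nz h1; rewrite z; lia.
  by exists p; rewrite pE; split=> //; lia.
rewrite foldl_max1; have [_ [_ h]] := max1_spec 0 (flatten (gains_of rows e)).
by move=> nz; case: h => [z|/inG[p pE]]; [rewrite z in nz|exists p; rewrite pE].
Qed.

Hypotheses (rows_nz : rows != [::]) (rows_72 : rows_ok rows).

Lemma listed_ok e p : piece_ok e -> listed rows e p != 0 -> position_ok (size rows) e p.
Proof.
case: p => g a eok; rewrite /listed /position_ok /gains_of /gains /=.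
have idx_lt : piece_idx e < 11 by case/andP: eok.
have row_sz g' : g' < size rows -> size (nth [::] rows g') = 72.
  by move=> lt; apply/eqP/(allP rows_72)/mem_nth.
have msk s : size s = piece_mod e -> nth 0 (masked e s) a != 0 ->
    (a < piece_mod e) && allowed e a.
  rewrite /masked /allowed => <-; case: (piece_mask e) => [b|].
    rewrite nth_apply_mask; case: nth => // nz; rewrite andbT.
    by apply: contraR nz; rewrite -leqNgt => /(nth_default 0)->.
  by move=> nz; rewrite andbT; apply: contraR nz; rewrite -leqNgt => /(nth_default 0)->.
case se: (piece_scope e) eok => eok.
- case: g => [|g] /=; last by rewrite nth_nil nth_nil.
  by apply: msk; rewrite size_total_sums.
- case: (ltnP g (size rows)) => [lt|ge]; last first.
    by rewrite [nth [::] _ g]nth_default ?size_map ?nth_nil.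
  rewrite (nth_map [::]) ?size_map // (nth_map [::]) //; apply: msk.
  by rewrite size_class_sums ?row_sz.
move: eok; rewrite /piece_ok se => /and3P[_ /eqP idx2 nomask].
case: (ltnP g (size rows)) => [lt|ge]; last first.
  by rewrite [nth [::] _ g]nth_default ?size_map ?nth_nil.
rewrite (nth_map [::]) ?size_map // (nth_map [::]) // => nz.
rewrite /allowed /piece_mod idx2; case: (piece_mask e) nomask => // _; rewrite andbT.
apply: contraR nz; rewrite -leqNgt => ge; rewrite nth_default //.
rewrite size_addv [X in maxn X _]size_addv !size_cat !size_drop !size_take.
by rewrite !size_total_sums // size_class_sums ?row_sz.
Qed.

Lemma choice_bound e l : piece_ok e -> choice_ok (size rows) e l ->
  weight rows (fun r x => has (fun p => hit e p r x) l) <=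
  (best_gains (piece_two e) (gains_of rows e)).1.
Proof.
move=> eok /andP[/eqP]; have one p : position_ok (size rows) e p ->
    weight rows (fun r x => hit e p r x) = listed rows e p.
  by move=> pok; rewrite /listed gainsP.
case: l => [|p [|q [|r l]]] //=; last by case: (piece_two e).
  move=> _ /andP[pok _]; apply: leq_trans (listed_le e p _); rewrite -one //.
  by apply: weight_le => r x _ _ _; rewrite orbF.
case: (piece_two e) => // _ /and3P[pok qok _].
have [->|ne] := eqVneq p q.
  apply: leq_trans (listed_le e q _); rewrite -one //.
  by apply: weight_le => r x _ _ _; rewrite orbF orbb.
apply: leq_trans (listed_pair e ne); rewrite -!one //.
apply: leq_trans (weightU _ _ _).
by apply: weight_le => r x _ _ _; rewrite orbF.
Qed.

End Bounds.

(** * Symmetries *)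

Definition swap_fun (s : swap) (x : nat) : nat := nth 0 (swap_perm s) x.

Record swap_ok (s : swap) : Prop := SwapOk {
  swap_lt : forall x, x < 72 -> swap_fun s x < 72;
  swapK : forall x, x < 72 -> swap_fun s (swap_fun s x) = x;
  swap_class : forall m x, m \in moduli -> x < 72 ->
    swap_fun s x %% m = swap_fun s (x %% m) %% m;
  swap_fixesP : forall i c,
    nth false (nth [::] (swap_fixes s) i) c ->
    swap_fun s c %% nth 1 moduli i = c;
  swap_decrP : forall i c,
    nth false (nth [::] (swap_decr s) i) c ->
    residue_key (nth 1 moduli i) (swap_fun s c %% nth 1 moduli i) <
    residue_key (nth 1 moduli i) c }.

Definition swap_okb (s : swap) : bool :=
  all (fun x => [&& swap_fun s x < 72, swap_fun s (swap_fun s x) == x &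
    all (fun m => swap_fun s x %% m == swap_fun s (x %% m) %% m) moduli]) (iota 0 72).

Lemma exchange_flags m a b t i c (s := exchange m a b t) :
  (nth false (nth [::] (swap_fixes s) i) c -> swap_fun s c %% nth 1 moduli i = c) /\
  (nth false (nth [::] (swap_decr s) i) c ->
    residue_key (nth 1 moduli i) (swap_fun s c %% nth 1 moduli i) <
    residue_key (nth 1 moduli i) c).
Proof.
cbv beta iota delta [s exchange swap_fixes swap_decr].
case: (ltnP i 11) => [lt_i|ge_i]; last first.
  by rewrite ![nth [::] _ i]nth_default ?nth_nil ?size_map.
rewrite ![nth [::] _ i](nth_map 1) //.
case: (ltnP c (nth 1 moduli i)) => [lt_c|ge_c]; last first.
  by rewrite ![nth false _ c]nth_default ?size_map ?size_iota.
by rewrite ![nth false _ c](nth_map 0) ?size_iota // !nth_iota // !add0n; split=> // /eqP.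
Qed.

Lemma exchange_ok m a b t : swap_okb (exchange m a b t) -> swap_ok (exchange m a b t).
Proof.
move=> /all_iotaP ok; split=> [x /ok /and3P[]|x /ok /and3P[_ /eqP]|q x qm /ok|i c|i c] //.
- by case/and3P=> _ _ /allP /(_ q qm) /eqP.
- by case: (exchange_flags m a b t i c).
- by case: (exchange_flags m a b t i c).
Qed.

Section SwapTheory.
Variables (s : swap) (sok : swap_ok s).
Let sg := swap_fun s.

Lemma swap_eq m a x : m \in moduli -> a < m -> x < 72 ->
  (sg x %% m == a) = (x %% m == sg a %% m).
Proof.
move=> mm lt_am lt_x.
have le_m72 : m <= 72 by move: mm; rewrite !inE; lia.
have lt_a := leq_trans lt_am le_m72.
have lt_xm : x %% m < 72 by apply: leq_ltn_trans (leq_mod _ _) _.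
apply/eqP/eqP => [<-|h].
  rewrite -(swap_class sok mm (swap_lt sok lt_x)) -/sg.
  by rewrite /sg (swapK sok).
rewrite (swap_class sok mm lt_x) h -/sg.
by rewrite -(swap_class sok mm (swap_lt sok lt_a)) (swapK sok) // modn_small.
Qed.

Lemma hit_swap e p r x : piece_ok e -> p.2 < piece_mod e -> x < 72 ->
  hit e p r (sg x) = hit e (p.1, sg p.2 %% piece_mod e) r x.
Proof.
move=> eok lt_a lt_x; rewrite /hit /=.
have mm : piece_mod e \in moduli.
  by rewrite mem_nth //; case/andP: eok.
case se: (piece_scope e) eok => eok; [by rewrite swap_eq|by rewrite swap_eq|].
move: eok; rewrite /piece_ok se => /and3P[_ /eqP idx2 _].
move: lt_a; rewrite /piece_mod idx2 /= => lt_a.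
rewrite [X in _ && (_ || ~~ X)]swap_eq // [X in X && _]swap_eq ?ltn_mod //.
by rewrite (@modn_dvdm 24 _ 8) // -(swap_class sok _ (leq_trans lt_a _)).
Qed.

Lemma swap_sum (F : nat -> nat) :
  \sum_(0 <= x < 72) F (sg x) = \sum_(0 <= x < 72) F x.
Proof.
rewrite -(big_map sg predT F); apply: perm_big; apply: uniq_perm.
- rewrite map_inj_in_uniq ?iota_uniq // => x y; rewrite !mem_index_iota => lx ly.
  by move/(congr1 sg); rewrite /sg !(swapK sok).
- exact: iota_uniq.
move=> x; rewrite mem_index_iota; apply/mapP/idP => [[y]|lt_x].
  by rewrite mem_index_iota => ly ->; rewrite (swap_lt sok).
by exists (sg x); rewrite ?mem_index_iota ?(swap_lt sok) // /sg (swapK sok).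
Qed.

Definition row_invariant (rows : seq (seq nat)) : Prop :=
  forall r x, r < size rows -> x < 72 -> entry rows r (sg x) = entry rows r x.

Lemma weight_swap rows e p : piece_ok e -> p.2 < piece_mod e -> row_invariant rows ->
  weight rows (hit e (p.1, sg p.2 %% piece_mod e)) = weight rows (hit e p).
Proof.
move=> eok lt_a inv; rewrite /weight !big_nat; apply: eq_bigr => r /= lt_r.
rewrite -[RHS](swap_sum) !big_nat; apply: eq_bigr => x /= lt_x.
by rewrite inv // hit_swap.
Qed.

Lemma compatible_position n e p : piece_ok e -> compatible e s -> position_ok n e p ->
  position_ok n e (p.1, sg p.2 %% piece_mod e).
Proof.
move=> _ /all_iotaP cmp /and3P[lt_g lt_a al]; rewrite /position_ok /=.
rewrite lt_g ltn_mod (leq_ltn_trans _ lt_a) //=.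
by have := cmp _ lt_a; rewrite al.
Qed.

Lemma coverable_swap n V els : all piece_ok els -> all (compatible^~ s) els ->
  coverable n V els -> coverable n (fun r x => V r (sg x)) els.
Proof.
move=> elsok cmp [ps [sz psok cov]].
pose f (ep : piece * seq (nat * nat)) :=
  [seq (p.1, sg p.2 %% piece_mod ep.1) | p <- ep.2].
exists [seq f ep | ep <- zip els ps].
have szf : size [seq f ep | ep <- zip els ps] = size els.
  by rewrite size_map size1_zip ?sz.
split=> // [|r x lt_r lt_x /(cov r _ lt_r (swap_lt sok lt_x))].
  elim: els ps sz psok elsok cmp {cov szf} => [|e els IH] [|l ps] //= [sz].
  move=> /andP[lok psok] /andP[eok elsok] /andP[ce cmp]; rewrite IH // andbT.
  move: lok => /andP[szl /allP lok]; rewrite /choice_ok size_map szl /=.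
  by apply/allP => _ /mapP[p /lok pok ->]; apply: compatible_position.
rewrite /hits; elim: els ps sz psok elsok {cmp cov szf} => [|e els IH] [|l ps] //= [sz].
move=> /andP[lok psok] /andP[eok elsok] /orP[|/IH->]; rewrite ?orbT //.
case/hasP => p pl hp; apply/orP; left; apply/hasP.
exists (p.1, sg p.2 %% piece_mod e); first exact: map_f.
rewrite -hit_swap //; case/andP: lok => _ /allP /(_ p pl) /and3P[] //.
Qed.

End SwapTheory.

Section RowSwap.
Variables (n g h : nat) (lt_g : g < n) (lt_h : h < n).
Let pi r := if r == g then h else if r == h then g else r.

Lemma row_swap_eq r k : (pi r == k) = (r == pi k).
Proof.
by rewrite /pi; case: (r =P g); case: (r =P h); case: (k =P g); case: (k =P h); lia.
Qed.

Lemma row_swap_lt r : r < n -> pi r < n.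
Proof. by rewrite /pi; case: ifP => // _; case: ifP. Qed.

Definition swap_position (e : piece) (p : nat * nat) : nat * nat :=
  (if piece_scope e is AllRows then p.1 else pi p.1, p.2).

Lemma hit_row_swap e p r x : hit e p (pi r) x = hit e (swap_position e p) r x.
Proof.
rewrite /hit /swap_position; case: (piece_scope e) => //=; by rewrite row_swap_eq.
Qed.

Lemma coverable_row_swap V els : coverable n V els ->
  coverable n (fun r x => V (pi r) x) els.
Proof.
move=> [ps [sz psok cov]].
exists [seq [seq swap_position ep.1 p | p <- ep.2] | ep <- zip els ps].
split=> [||r x lt_r lt_x /(cov _ _ (row_swap_lt lt_r) lt_x)].
- by rewrite size_map size1_zip ?sz.
- elim: els ps sz psok {cov} => [|e els IH] [|l ps] //= [sz].
  move=> /andP[/andP[szl /allP lok] psok]; rewrite IH // andbT /choice_ok size_map szl /=.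
  apply/allP => _ /mapP[p /lok /and3P[lt_p lt_a al] ->].
  rewrite /position_ok /= lt_a al andbT.
  by move: lt_p; case: (piece_scope e) => lt_p; rewrite ?(row_swap_lt lt_p) // lt_p.
rewrite /hits; elim: els ps sz psok {cov} => [|e els IH] [|l ps] //= [sz].
move=> /andP[_ psok] /orP[|/IH->]; rewrite ?orbT //.
case/hasP => p pl hp; apply/orP; left; apply/hasP.
by exists (swap_position e p); [apply: map_f|rewrite -hit_row_swap].
Qed.

End RowSwap.

(** * Soundness of the search *)

Definition valid_bound (rows : seq (seq nat)) (e : piece) (b : nat) : Prop :=
  forall l, choice_ok (size rows) e l ->
    weight rows (fun r x => has (fun p => hit e p r x) l) <= b.

Fixpoint valid_bounds (rows : seq (seq nat)) (els : seq piece) (bs : seq nat) : Prop :=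
  match els, bs with
  | [::], [::] => True
  | e :: els', b :: bs' => valid_bound rows e b /\ valid_bounds rows els' bs'
  | _, _ => False
  end.

Lemma valid_bounds_cat rows els1 els2 bs1 bs2 :
  valid_bounds rows els1 bs1 -> valid_bounds rows els2 bs2 ->
  valid_bounds rows (els1 ++ els2) (bs1 ++ bs2).
Proof.
elim: els1 bs1 => [|e els1 IH] [|b bs1] //= [h1 h2] h3; split=> //.
exact: IH.
Qed.

Lemma valid_bounds_take rows els bs i : valid_bounds rows els bs ->
  valid_bounds rows (take i els) (take i bs).
Proof.
elim: els bs i => [|e els IH] [|b bs] [|i] //= [h1 h2]; split=> //.
exact: IH.
Qed.

Lemma valid_bounds_drop rows els bs i : valid_bounds rows els bs ->
  valid_bounds rows (drop i els) (drop i bs).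
Proof.
by elim: els bs i => [|e els IH] [|b bs] [|i] //= [h1 h2]; apply: IH.
Qed.

Definition total (rows : seq (seq nat)) : nat := weight rows (fun _ _ => true).

Lemma weight_place rows e p (S : nat -> nat -> bool) :
  piece_ok e -> position_ok (size rows) e p ->
  weight (place e p rows) S <= weight rows S.
Proof.
move=> eok pok; rewrite /weight size_place !big_nat; apply: leq_sum => r /= lt_r.
rewrite !big_nat; apply: leq_sum => x /= lt_x.
by rewrite placeP // leq_mul2r; case: hit; rewrite ?leq0n ?leqnn orbT.
Qed.

Lemma total_place rows e p : piece_ok e -> position_ok (size rows) e p ->
  total rows <= total (place e p rows) + weight rows (hit e p).
Proof.
move=> eok pok; rewrite /total /weight size_place -big_split /= !big_nat.
apply: leq_sum => r /= lt_r; rewrite -big_split /= !big_nat.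
apply: leq_sum => x /= lt_x.
by rewrite placeP //; case: hit; rewrite ?muln1 ?muln0 ?addn0.
Qed.

Fixpoint choice_weight (rows : seq (seq nat)) (els : seq piece)
    (ps : seq (seq (nat * nat))) : nat :=
  match els, ps with
  | e :: els', l :: ps' =>
      weight rows (fun r x => has (fun p => hit e p r x) l) +
      choice_weight rows els' ps'
  | _, _ => 0
  end.

Lemma hits_weight rows els ps :
  weight rows (hits els ps) <= choice_weight rows els ps.
Proof.
elim: els ps => [|e els IH] [|l ps] /=; rewrite ?leqn0 /hits /=;
  try by rewrite /weight big1 // => r _; rewrite big1 // => x _; rewrite muln0.
apply: leq_trans (leq_add (leqnn _) (IH ps)).
exact: weightU.
Qed.

Lemma choice_weight_cat rows els1 els2 ps1 ps2 : size els1 = size ps1 ->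
  choice_weight rows (els1 ++ els2) (ps1 ++ ps2) =
  choice_weight rows els1 ps1 + choice_weight rows els2 ps2.
Proof.
by elim: els1 ps1 => [|e els1 IH] [|l ps1] //= [sz]; rewrite IH // addnA.
Qed.

Definition choices_ok n (els : seq piece) ps : bool :=
  (size ps == size els) && all (fun ep => choice_ok n ep.1 ep.2) (zip els ps).

Lemma choices_ok_cons n e els l ps :
  choices_ok n (e :: els) (l :: ps) = choice_ok n e l && choices_ok n els ps.
Proof. by rewrite /choices_ok /= eqSS andbCA. Qed.

Lemma choices_ok_cat n els1 els2 ps1 ps2 : size ps1 = size els1 ->
  choices_ok n (els1 ++ els2) (ps1 ++ ps2) =
  choices_ok n els1 ps1 && choices_ok n els2 ps2.
Proof.
elim: els1 ps1 => [|e els1 IH] [|l ps1] //= [sz].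
by rewrite !choices_ok_cons IH // andbA.
Qed.

Lemma choice_weight_bound rows els ps bs : valid_bounds rows els bs ->
  choices_ok (size rows) els ps -> choice_weight rows els ps <= sumn bs.
Proof.
elim: els ps bs => [|e els IH] [|l ps] [|b bs] //= [vb vbs].
by rewrite choices_ok_cons => /andP[lok psok]; apply: leq_add; [apply: vb|apply: IH].
Qed.

Section Node.
Variable rows : seq (seq nat).
Hypotheses (rows_nz : rows != [::]) (rows_72 : rows_ok rows).
Let n := size rows.
Let Ts := map class_sums rows.

Lemma info_valid els : all piece_ok els ->
  valid_bounds rows els (map bound_of (map (info_of Ts) els)).
Proof.
elim: els => //= e els IH /andP[eok elsok]; split; last exact: IH.
by move=> l lok; apply: choice_bound.
Qed.

(** At every stage the treated pieces have their sharper bounds, summed in [done], and the others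
    still have valid old ones. Their sum must reach the total weight, which rules out early failure
    and keeps the subtraction exact. *)
Lemma tighten_ok els ps olds excess done : all piece_ok els ->
  valid_bounds rows els olds -> choices_ok n els ps ->
  done + sumn olds <= total rows + excess ->
  total rows <= done + choice_weight rows els ps ->
  exists2 slack, tighten excess olds (map (info_of Ts) els) = Some slack
    & done + sumn (map bound_of (map (info_of Ts) els)) <= total rows + slack.
Proof.
elim: els ps olds excess done => [|e els IH] [|l ps] [|old olds] excess done //=.
  by move=> _ _ _ h _; exists excess.
move=> /andP[eok elsok] [vb vbs]; rewrite choices_ok_cons => /andP[lok psok] h1 h2.
rewrite /bound_of /=; have := choice_bound rows_nz rows_72 eok lok.
rewrite /gains_of -/Ts; case: best_gains => b las /= le_b; rewrite leqbE.
have le_s := choice_weight_bound vbs psok.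
have le_old : old <= excess + b by lia.
rewrite le_old; have [] := IH ps olds (excess + b - old) (done + b) elsok vbs psok.
- by lia.
- by lia.
by move=> slack eq_s le_t; exists slack => //; rewrite addnA.
Qed.

End Node.

Definition uncovered (rows : seq (seq nat)) (r x : nat) : bool := entry rows r x != 0.

Lemma thresholdE slack last : threshold slack last = maxn 1 (last - slack).
Proof. by rewrite /threshold; case: (last - slack) => // k; rewrite maxnSS max0n. Qed.

Lemma remaining_ok e : piece_ok e -> all piece_ok (remaining e).
Proof. by rewrite /remaining; case: piece_two => //= h; rewrite andbT. Qed.

Section Viable.
Variable rows : seq (seq nat).
Hypotheses (rows_nz : rows != [::]) (rows_72 : rows_ok rows).
Let n := size rows.
Let Ts := map class_sums rows.

Lemma weight0 e p r x : weight rows (hit e p) = 0 -> r < n -> x < 72 ->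
  uncovered rows r x -> ~~ hit e p r x.
Proof.
move=> /eqP; rewrite /weight sum_nat_seq_eq0 => /allP h0 lt_r lt_x.
have := h0 r; rewrite mem_index_iota lt_r => /(_ isT) /=.
rewrite sum_nat_seq_eq0 => /allP /(_ x); rewrite mem_index_iota lt_x => /(_ isT) /=.
by rewrite muln_eq0 /uncovered => /orP[->//|]; rewrite eqb0.
Qed.

Lemma best_gains_le two s : (best_gains two s).2 <= (best_gains two s).1.
Proof. by rewrite /best_gains; case: two => //=; apply: leq_addl. Qed.

Lemma listed_le_rest e p :
  listed rows e p <= (best_gains true (gains e Ts)).1 - (best_gains true (gains e Ts)).2.
Proof.
have := listed_le rows e p false; rewrite /gains_of -/Ts.
have [h _ _ _ _] := @max2_spec 0 0 (flatten (gains e Ts)) isT.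
rewrite /best_gains foldl_max1 foldl_max2 /= addnK => h1.
apply: leq_trans h1 _.
have [_ [_ [->//|mem]]] := max1_spec 0 (flatten (gains e Ts)).
have [_ _ h2 _ _] := @max2_spec 0 0 (flatten (gains e Ts)) isT.
by have [] := h2 _ mem.
Qed.

(* A copy of e that gains nothing in the given covering can be moved anywhere. *)
Lemma viable_position e L R PL l PR slack (B := best_gains (piece_two e) (gains e Ts)) :
  all piece_ok (L ++ e :: R) -> size PL = size L ->
  choices_ok n (L ++ e :: R) (PL ++ l :: PR) ->
  (forall r x, r < n -> x < 72 -> uncovered rows r x ->
     hits (L ++ e :: R) (PL ++ l :: PR) r x) ->
  sumn (map bound_of (map (info_of Ts) (L ++ e :: R))) <= total rows + slack ->
  B.1 != 0 ->
  exists p, [/\ position_ok n e p, threshold slack B.2 <= listed rows e p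
    & coverable n (uncovered (place e p rows)) (L ++ remaining e ++ R)].
Proof.
rewrite all_cat /= => /and3P[Lok eok Rok] szL.
rewrite choices_ok_cat // choices_ok_cons => /and3P[PLok lok PRok] cov sumB nzB.
case: l lok cov => [|p0 l'] lok cov; first by case/andP: lok.
have p0ok : position_ok n e p0 by case/and3P: lok.
have gain0 : weight rows (hit e p0) = listed rows e p0 by rewrite /listed gainsP.
pose mid := if piece_two e then [:: l'] else [::].
have midok : choices_ok n (remaining e) mid.
  move: lok; rewrite /choice_ok /remaining /mid /choices_ok /=; case: piece_two => //=.
  case/and3P => sz _ al; rewrite eqSS in sz; rewrite andbT; exact/andP.
have cov' r x : r < n -> x < 72 -> uncovered rows r x -> ~~ hit e p0 r x ->
    hits (L ++ remaining e ++ R) (PL ++ mid ++ PR) r x.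
  move=> lt_r lt_x /(cov r x lt_r lt_x); rewrite !hits_cat //; last first.
    by rewrite /remaining /mid; case: piece_two.
  case/orP => [->//|]; rewrite /hits /=.
  case/orP => [/orP[->//|h _]|->]; last by rewrite !orbT.
  apply/orP; right; apply/orP; left.
  rewrite /remaining /mid; move: lok h; rewrite /choice_ok; case: piece_two.
    by move=> _ h /=; rewrite orbF.
  by rewrite /= eqSS => /andP[/eqP/size0nil->].
have coverable_after q : (forall r x, r < n -> x < 72 ->
    uncovered (place e q rows) r x -> uncovered rows r x /\ ~~ hit e p0 r x) ->
  coverable n (uncovered (place e q rows)) (L ++ remaining e ++ R).
  move=> h; exists (PL ++ mid ++ PR).
  have ok : choices_ok n (L ++ remaining e ++ R) (PL ++ mid ++ PR).
    rewrite choices_ok_cat // choices_ok_cat; last by case/andP: midok => /eqP.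
    by rewrite PLok midok.
  case/andP: ok => /eqP sz ok; split=> // r x lt_r lt_x /(h r x lt_r lt_x)[u nh].
  exact: cov'.
(* The weight left is at most the gain of [p0], plus [B.1 - B.2] for the other copy if there is one,
   plus the bounds of the other pieces; all the bounds together exceed it by at most [slack]. *)
have le_last : B.2 <= slack + listed rows e p0.
  have tot : total rows <= choice_weight rows (L ++ e :: R) (PL ++ (p0 :: l') :: PR).
    apply: leq_trans (hits_weight _ _ _); apply: weight_le => r x lt_r lt_x u _.
    exact: cov.
  move: tot sumB; rewrite choice_weight_cat // !map_cat sumn_cat /=.
  have := choice_weight_bound (info_valid rows_nz rows_72 Lok) PLok.
  have := choice_weight_bound (info_valid rows_nz rows_72 Rok) PRok.
  rewrite -/Ts.
  have: weight rows (fun r x => hit e p0 r x || has (fun p => hit e p r x) l') <=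
     listed rows e p0 + (B.1 - B.2).
    rewrite -gain0; apply: leq_trans (weightU _ _ _) _; rewrite leq_add2l.
    move: lok; rewrite /B /choice_ok; case: (piece_two e).
      case: l' {cov mid midok cov' coverable_after} => [|q [|]] //= /and3P[_ qok _].
      apply: leq_trans (listed_le_rest e q); rewrite /listed gainsP //.
      by apply: weight_le => r x _ _ _; rewrite orbF.
    rewrite /= eqSS => /andP[/eqP/size0nil-> _].
    by rewrite /weight big1 // => r _; rewrite big1 // => x _; rewrite muln0.
  have le_B : B.2 <= B.1 by apply: best_gains_le.
  by rewrite /bound_of /= -/B; move: le_B; clear; lia.
have [z|nz] := eqVneq (listed rows e p0) 0; last first.
  exists p0; split=> //.
    by rewrite thresholdE geq_max lt0n nz leq_subLR.
  apply: coverable_after => r x lt_r lt_x; rewrite /uncovered placeP //.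
  by case: ifP.
have [q [nzq le_q]] := best_last nzB.
have qok : position_ok n e q by apply: listed_ok.
exists q; split=> //.
  by rewrite thresholdE geq_max lt0n nzq (leq_trans (leq_subr _ _)).
apply: coverable_after => r x lt_r lt_x; rewrite /uncovered placeP //.
case: ifP => // _ u; split=> //; apply: weight0 => //.
by rewrite gain0.
Qed.

End Viable.

Lemma coverable_ext n (V1 V2 : nat -> nat -> bool) els :
  (forall r x, r < n -> x < 72 -> V2 r x -> V1 r x) ->
  coverable n V1 els -> coverable n V2 els.
Proof.
move=> sub [ps [sz ok cov]]; exists ps; split=> // r x lt_r lt_x /(sub r x lt_r lt_x).
exact: cov.
Qed.

Lemma update_sums_place rows e p : piece_ok e -> position_ok (size rows) e p ->
  update_sums e p (place e p rows) (map class_sums rows) =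
  map class_sums (place e p rows).
Proof.
move=> eok /and3P[lt_p _ _]; rewrite /update_sums.
case se: (piece_scope e) lt_p => // lt_p; apply: (@eq_from_nth _ [::]).
  by rewrite size_set_nth !size_map size_place; apply/maxn_idPr.
move=> r; rewrite size_set_nth !size_map (maxn_idPr lt_p) => lt_r.
rewrite nth_set_nth /= [RHS](nth_map [::]) ?size_place //.
case: (eqVneq r p.1) => [->//|ne]; rewrite (nth_map [::]) // /place se nth_mapi //.
by rewrite add0n eqnE (negbTE ne).
Qed.

Lemma sumn_take_drop (s : seq nat) i : i < size s ->
  sumn s = sumn (take i s) + nth 0 s i + sumn (drop i.+1 s).
Proof.
move=> lt_i; rewrite -{1}(cat_take_drop i s) sumn_cat (drop_nth 0) //=.
by rewrite addnA.
Qed.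

(** A covering provides a viable position of the selected piece. Symmetries preserving the rows and
    the remaining pieces move it to a position that the search tries, and the covering that remains
    contradicts the induction hypothesis. *)
Theorem refute_sound fuel rows sws els olds excess :
  rows != [::] -> rows_ok rows -> all piece_ok els ->
  valid_bounds rows els olds -> sumn olds <= total rows + excess ->
  (forall s, List.In s sws ->
     [/\ swap_ok s, row_invariant s rows & all (compatible^~ s) els]) ->
  refute fuel rows (map class_sums rows) sws els olds excess ->
  ~ coverable (size rows) (uncovered rows) els.
Proof.
elim: fuel rows sws els olds excess => [|f IH] rows sws els olds excess //=.
move=> nz ok elsok vb sum_olds swsok; set Ts := map class_sums rows; set n := size rows.
set info := map (info_of Ts) els => ref [ps [szps psok cov]].
have psok' : choices_ok n els ps by rewrite /choices_ok szps eqxx.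
have tot : total rows <= choice_weight rows els ps.
  apply: leq_trans (hits_weight _ _ _); apply: weight_le => r x lt_r lt_x u _.
  exact: cov.
have [slack eq_slack sum_bs] :=
  tighten_ok nz ok elsok vb psok' (sum_olds : 0 + _ <= _) tot.
move: ref; rewrite -/info -/Ts in eq_slack sum_bs *; rewrite eq_slack {eq_slack}.
set i := choose _ _ _ _ _ _; set bs := map bound_of info.
case dropE: (drop i info) => [|[[e g] [b last]] rest] //.
have lt_i : i < size els.
  rewrite ltnNge; apply/negP => ge_i.
  by move: dropE; rewrite drop_oversize // size_map.
have eE : els = take i els ++ e :: drop i.+1 els /\
    (g = gains e Ts /\ best_gains (piece_two e) (gains e Ts) = (b, last)).
  pose e0 := mk_piece AllRows 1 72 false.
  have iE : info_of Ts (nth e0 els i) = (e, g, (b, last)).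
    have := congr1 (head (e, g, (b, last))) dropE.
    by rewrite /info -map_drop (drop_nth e0).
  case: iE => eE gE bE; rewrite -eE -drop_nth // cat_take_drop; split=> //.
case: eE => elsE [gE BE].
set L := take i els in elsE *; set R := drop i.+1 els in elsE *.
rewrite eqnE; case: (eqVneq b 0) => // nzb ref.
have eok : piece_ok e by move: elsok; rewrite elsE all_cat /= => /and3P[].
have Lok : all piece_ok L by move: elsok; rewrite elsE all_cat => /andP[].
have Rok : all piece_ok R by move: elsok; rewrite elsE all_cat /= => /and3P[].
have elsok' : all piece_ok (L ++ remaining e ++ R).
  by rewrite !all_cat Lok Rok remaining_ok.
set els' := L ++ remaining e ++ R in ref elsok'.
have bsE : bs = map bound_of (map (info_of Ts) L) ++ b :: map bound_of (map (info_of Ts) R).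
  by rewrite /bs /info {1}elsE !map_cat /= /bound_of /= BE.
have lastb : last <= b.
  have := BE; rewrite /best_gains; case: piece_two => [] [<- <-] //.
  exact: leq_addl.
set good := fun p => [/\ position_ok n e p, threshold slack last <= listed rows e p
    & coverable n (uncovered (place e p rows)) els'].
have good_ex : exists p, good p.
  pose PL := take i ps; pose PR := drop i.+1 ps; pose l := nth [::] ps i.
  have psE : ps = PL ++ l :: PR.
    by rewrite /PL /l /PR -drop_nth ?szps // cat_take_drop.
  have szPL : size PL = size L by rewrite !size_takel ?szps // ltnW.
  have := @viable_position rows nz ok e L R PL l PR slack.
  rewrite -elsE -psE BE; apply=> //.
have idx_eq : piece_mod e = nth 1 moduli (piece_idx e) by [].
have cls_eq p : piece_scope e = AllRows -> position_ok n e p -> p.1 = 0.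
  by move=> se /and3P[]; rewrite se => /eqP.
have cmp_els' s : List.In s sws -> all (compatible^~ s) els' /\ compatible e s.
  case/swsok=> _ _; rewrite {1}elsE !all_cat /= => /and3P[cL ce cR]; split=> //.
  rewrite cL cR andbT /= /remaining; case: piece_two => //=.
  by rewrite andbT; exact: ce.
have [p [pok le_p covp] [newp unflagged]] : exists2 p, good p &
    new_row rows p.1 /\ ~~ flagged sws (piece_idx e) p.2.
  case: good_ex => p.
  have [m] := ubnP (p.1 + residue_key (piece_mod e) p.2); elim: m p => // m IHm p.
  rewrite ltnS => le_m gp; have [pok le_p covp] := gp.
  (* p may be replaced by its image under a symmetry until p.1 + residue_key is
     minimal. *)
  case newp: (new_row rows p.1); last first.
    move: newp; rewrite /new_row hasbE => /negbFE/hasP[row].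
    have nA : piece_scope e <> AllRows -> p.1 < n.
      by case/and3P: pok => + _ _; case: piece_scope.
    move=> /(nthP [::])[h lt_h hE]; rewrite eqseqbE => /eqP eq_row.
    have lt_hp : h < p.1.
      by move: lt_h; rewrite size_take_min leq_min => /andP[].
    have se : piece_scope e <> AllRows.
      by move=> /cls_eq /(_ pok) z; rewrite z in lt_hp.
    have lt_pn := nA se; have lt_hn := ltn_trans lt_hp lt_pn.
    rewrite nth_take // in hE; rewrite -hE in eq_row.
    apply: (IHm (h, p.2)); first by apply: leq_trans le_m; rewrite ltn_add2r.
    have pos_h : position_ok n e (h, p.2).
      case/and3P: pok => _ lt_a al; rewrite /position_ok /= lt_a al !andbT.
      by case: (piece_scope e) se => [[]||].
    have Weq x : entry rows h x = entry rows p.1 x by rewrite /entry eq_row.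
    split=> //.
      apply: leq_trans le_p _; rewrite /listed /gains_of /gains /=.
      case: (piece_scope e) se => [[]//|_|_].
        by rewrite -map_comp !(nth_map [::]) //= eq_row.
      by rewrite -map_comp !(nth_map [::]) //= eq_row.
    have := coverable_row_swap lt_pn lt_hn covp; apply: coverable_ext => r x lt_r lt_x.
    have lt_r' := row_swap_lt lt_pn lt_hn lt_r.
    rewrite /uncovered !placeP // (hit_row_swap lt_pn lt_hn) /swap_position.
    have -> : (if piece_scope e is AllRows then p.1 else
               if p.1 == p.1 then h else if p.1 == h then p.1 else p.1) = h.
      by rewrite eqxx; case: (piece_scope e) se => [[]||].
    case: hit => //; case: (r =P p.1) => [->|_]; first by rewrite Weq.
    by case: (r =P h) => [->|] //; rewrite Weq.
  case fl: (flagged sws (piece_idx e) p.2); last by exists p; rewrite ?fl.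
  move: fl; rewrite /flagged hasbE => fl.
  have [s s_in dec] : exists2 s, List.In s sws &
      nth false (nth [::] (swap_decr s) (piece_idx e)) p.2.
    elim: (sws) fl => //= s sws' IHs /orP[h|/IHs[s' ? ?]]; first by exists s; [left|].
    by exists s'; [right|].
  have [sok inv _] := swsok s s_in; have [cmp ce] := cmp_els' s s_in.
  have lt_p2 : p.2 < piece_mod e by case/and3P: pok.
  apply: (IHm (p.1, swap_fun s p.2 %% piece_mod e)).
    apply: leq_trans le_m; rewrite ltn_add2l idx_eq; exact: (swap_decrP sok).
  have pok' := compatible_position eok ce pok.
  split=> //.
    apply: leq_trans le_p _; rewrite /listed !gainsP //.
    by rewrite weight_swap.
  have := coverable_swap sok elsok' cmp covp; apply: coverable_ext => r x lt_r lt_x.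
  by rewrite /uncovered !placeP // (hit_swap sok) // inv.
move: covp; have nzp : listed rows e p != 0.
  by rewrite -lt0n (leq_trans _ le_p) // thresholdE leq_max.
have lt_p2 : p.2 < size (nth [::] g p.1).
  rewrite gE; apply: contraR nzp; rewrite -leqNgt /listed /gains_of => ge.
  by rewrite nth_default.
have lt_p1 : p.1 < size g.
  rewrite ltnNge; apply/negP => ge; move: lt_p2; by rewrite (nth_default _ ge).
move: ref => /(allibP [::]) /(_ _ lt_p1); rewrite add0n newp.
move=> /(allibP 0) /(_ _ lt_p2); rewrite add0n -/Ts.
have xE : nth 0 (nth [::] g p.1) p.2 = listed rows e p by rewrite gE.
rewrite xE leqbE le_p (negbTE unflagged).
have -> : (p.1, p.2) = p by case: (p).
rewrite update_sums_place // => ref.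
have lt_last : last - slack <= listed rows e p.
  by move: le_p; rewrite thresholdE geq_max => /andP[].
rewrite /n -(size_place e p rows); apply: IH ref => //.
- by rewrite -size_eq0 size_place size_eq0.
- exact: place_ok.
- have vbs := info_valid nz ok elsok.
  have mono e1 b1 : valid_bound rows e1 b1 -> valid_bound (place e p rows) e1 b1.
    move=> v l; rewrite size_place => /v; apply: leq_trans; exact: weight_place.
  have monos els1 bs1 : valid_bounds rows els1 bs1 ->
      valid_bounds (place e p rows) els1 bs1.
    by elim: els1 bs1 => [|e1 els1 IH1] [|b1 bs1] //= [/mono ? /IH1].
  apply: valid_bounds_cat; first by apply/monos/valid_bounds_take.
  apply: valid_bounds_cat; last by apply/monos/valid_bounds_drop.
  rewrite /remaining /old_remaining; case two: (piece_two e) => //=; split=> //.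
  apply: mono => l; rewrite /choice_ok; case: l => [|q [|]] //= /andP[qok _].
  have := listed_le_rest rows e q; rewrite -/Ts; move: BE; rewrite two => -> /=.
  apply: leq_trans; rewrite /listed gainsP //.
  by apply: weight_le => r x _ _ _; rewrite orbF.
- have := total_place eok pok.
  have -> : weight rows (hit e p) = listed rows e p by rewrite /listed gainsP.
  rewrite !sumn_cat -/bs; have := sum_bs; rewrite add0n -/bs.
  have szbs : i < size bs by rewrite !size_map.
  rewrite (sumn_take_drop szbs).
  have -> : nth 0 bs i = b.
    by rewrite bsE nth_cat !size_map size_takel ?(ltnW lt_i) // ltnn subnn.
  have : sumn (old_remaining e b last) + last = b.
    rewrite /old_remaining; case two: (piece_two e) => /=; first by rewrite addn0 subnK.
    by move: BE; rewrite two => -[-> ->].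
  by move: lt_last; clear; lia.
(* A swap fixing the class of [p] preserves the cells just cleared, so the new rows are still
   invariant under it. *)
- move=> s; rewrite /stabilizer => s_in.
  have [s_in' fix_s] : List.In s sws /\
      nth false (nth [::] (swap_fixes s) (piece_idx e)) p.2.
    elim: (sws) s_in => //= s1 sws1 IHs; case: ifP => [h|_] /=.
      by case=> [<-|/IHs[? ?]]; [split=> //; left|split=> //; right].
    by case/IHs=> ? ?; split=> //; right.
  have [sok inv _] := swsok s s_in'; have [cmp ce] := cmp_els' s s_in'.
  split=> // r x; rewrite size_place => lt_r lt_x.
  have lt_p2m : p.2 < piece_mod e by case/and3P: pok.
  rewrite !placeP // (hit_swap sok) // inv //.
  by rewrite idx_eq (swap_fixesP sok fix_s); case: (p).
Qed.

(** * Dropping and merging moduli *)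

Definition in_class (r : nat -> nat) (x m : nat) : bool := x == r m %[mod m].

(** As the moduli are distinct, a system amounts to a list of moduli with a function giving the
    residue of each; covering the natural numbers is enough for a contradiction. *)
Definition covers (r : nat -> nat) (S : seq nat) : Prop :=
  forall x, has (in_class r x) S.

Lemma pfactor_dvd_lcm p k a b : prime p -> p ^ k %| lcmn a b ->
  (p ^ k %| a) || (p ^ k %| b).
Proof.
move=> pp; case: a => [|a]; first by rewrite dvdn0.
case: b => [|b]; first by rewrite dvdn0 orbT.
by rewrite !pfactor_dvdn ?lcmn_gt0 // logn_lcm // leq_max.
Qed.

Lemma pfactor_dvd_biglcm p k (S : seq nat) : prime p -> 0 < k ->
  p ^ k %| foldr lcmn 1 S -> has (dvdn (p ^ k)) S.
Proof.
move=> pp k_gt0; elim: S => [|m S IH] /=; last first.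
  by move=> /(pfactor_dvd_lcm pp)/orP[->//|/IH->]; rewrite orbT.
by rewrite dvdn1 -(expn0 p) eqn_exp2l ?prime_gt1 // => /eqP k0; rewrite k0 in k_gt0.
Qed.

Lemma dvd_biglcm m (S : seq nat) : m \in S -> m %| foldr lcmn 1 S.
Proof.
elim: S => //= n S IH; rewrite inE => /predU1P[->|/IH h]; first exact: dvdn_lcml.
exact: dvdn_trans h (dvdn_lcmr _ _).
Qed.

Lemma in_class_shift r x t m : m %| t -> in_class r (x + t) m = in_class r x m.
Proof. by move=> /dvdnP[q ->]; rewrite /in_class addnC modnMDl. Qed.

Lemma covers_drop p k r S : prime p -> 0 < k ->
  count (dvdn (p ^ k)) S < p ->
  covers r S -> covers r (filter (fun m => ~~ (p ^ k %| m)) S).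
Proof.
move=> pp k_gt0 few cov x; apply/negPn/negP => /hasPn miss.
(* The surviving moduli all divide [T], so they miss every [x + j * T]; [f j] is a dropped modulus
   that catches it. With fewer than [p] such moduli, two of the first [p] translates share one. *)
set T := foldr lcmn 1 [seq m <- S | ~~ (p ^ k %| m)].
have T_nd : ~~ (p ^ k %| T).
  apply/negP => /(pfactor_dvd_biglcm pp k_gt0)/hasP[m].
  by rewrite mem_filter => /andP[/negP].
pose f j := nth 0 S (find (in_class r (x + j * T)) S).
have fP j : in_class r (x + j * T) (f j) by apply: nth_find; apply: cov.
have fS j : f j \in S by rewrite mem_nth // -has_find; apply: cov.
have fB j : f j \in filter (dvdn (p ^ k)) S.
  rewrite mem_filter fS andbT; apply/negPn/negP => nd.
  have fj_in : f j \in [seq m <- S | ~~ (p ^ k %| m)] by rewrite mem_filter nd fS.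
  have /negP := miss _ fj_in; case.
  by rewrite -(in_class_shift _ _ (dvdn_mull j (dvd_biglcm fj_in))).
have : ~~ uniq [seq f j | j <- iota 0 p].
  have sub : {subset [seq f j | j <- iota 0 p] <= filter (dvdn (p ^ k)) S}.
    by move=> _ /mapP[j _ ->].
  apply/negP => /uniq_leq_size/(_ sub).
  by rewrite size_map size_iota size_filter leqNgt few.
case/(uniqPn 0)=> i [j []]; rewrite size_map size_iota => lt_ij lt_jp.
have lt_ip := ltn_trans lt_ij lt_jp.
rewrite !(nth_map 0) ?size_iota // !nth_iota // !add0n => eq_f.
(* The shared modulus, a multiple of [p ^ k], divides [(j - i) * T]. Since 0 < j - i < p is prime to
   [p], the power would divide [T]. *)
have /eqP : x + i * T == x + j * T %[mod f i].
  by rewrite (eqP (fP i)) eq_f (eqP (fP j)).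
move/eqP; rewrite eqn_modDl eq_sym eqn_mod_dvd ?leq_mul2r ?(ltnW lt_ij) ?orbT //.
rewrite -mulnBl => /(dvdn_trans _) dvd; have := fB i.
rewrite mem_filter => /andP[/dvd]; rewrite Gauss_dvdr ?(negPf T_nd) //.
rewrite coprimeXl // prime_coprime //; apply/negP => /dvdn_leq.
by rewrite subn_gt0 lt_ij leqNgt (leq_ltn_trans (leq_subr _ _)) // => /(_ isT).
Qed.

(** The order matters: 27, 54 and 81 are three multiples of 27, so 81 has to go before the step for
    27. The modulus 108 would again be a third one. *)
Definition drop_steps : seq (nat * nat) :=
  [seq (p, 1) | p <- [:: 11; 13; 17; 19; 23; 29; 31; 37; 41; 43; 47; 53; 59; 61;
     67; 71; 73; 79; 83; 89; 97; 101; 103; 107]] ++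
  [:: (7, 2); (5, 2); (3, 4); (3, 3); (2, 6)].

Definition drop_step (S : seq nat) (pk : nat * nat) : seq nat :=
  filter (fun m => ~~ (pk.1 ^ pk.2 %| m)) S.

Fixpoint droppable (S : seq nat) (l : seq (nat * nat)) : bool :=
  if l is pk :: l' then
    [&& prime pk.1, 0 < pk.2, count (dvdn (pk.1 ^ pk.2)) S < pk.1 &
        droppable (drop_step S pk) l']
  else true.

Lemma covers_drops r S l : droppable S l -> covers r S -> covers r (foldl drop_step S l).
Proof.
elim: l S => //= [[p k] l IH] S /and4P[pp k_gt0 few /IH h] cov.
by apply: h; apply: covers_drop.
Qed.

Definition light : seq nat :=
  [:: 5; 6; 8; 9; 10; 12; 15; 18; 20; 24; 30; 36; 40; 45; 60; 72; 90].

Definition sevens : seq nat := [:: 7; 14; 21; 28; 42; 56; 63; 84; 35; 70; 105].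

Lemma covers_smooth r : covers r (iota 5 103) ->
  covers r (light ++ sevens ++ [:: 16; 48; 80; 32; 96]).
Proof.
move=> /(@covers_drops r _ drop_steps) cov x.
have /cov /(_ x) /hasP[m m_in xm] : droppable (iota 5 103) drop_steps by vm_compute.
apply/hasP; exists m => //.
apply: (allP (s := foldl drop_step (iota 5 103) drop_steps)) m_in.
by vm_compute.
Qed.

(** * The multiples of 7 *)

(* Exponents of 2, 3 and 5. *)
Definition expo : Type := (nat * nat * nat)%type.

Definition modulus (e : expo) : nat := 2 ^ e.1.1 * 3 ^ e.1.2 * 5 ^ e.2.

Definition divides (e f : expo) : bool :=
  [&& e.1.1 <= f.1.1, e.1.2 <= f.1.2 & e.2 <= f.2].

Definition join (e f : expo) : expo :=
  (maxn e.1.1 f.1.1, maxn e.1.2 f.1.2, maxn e.2 f.2).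

Lemma modulusP e x y : (x == y %[mod modulus e]) =
  [&& x == y %[mod 2 ^ e.1.1], x == y %[mod 3 ^ e.1.2] & x == y %[mod 5 ^ e.2]].
Proof.
by rewrite andbA -!chinese_remainder // ?coprimeMl !(coprimeXl, coprimeXr).
Qed.

Lemma modulus_dvd e f : divides e f -> modulus e %| modulus f.
Proof. by case/and3P=> h1 h2 h3; rewrite !dvdn_mul // dvdn_exp2l. Qed.

Lemma eqn_mod_dvdl d m x y : d %| m -> x == y %[mod m] -> x == y %[mod d].
Proof. by move=> dm /eqP h; rewrite -(modn_dvdm x dm) h modn_dvdm. Qed.

Lemma modulus_join e f x y : x == y %[mod modulus e] -> x == y %[mod modulus f] ->
  x == y %[mod modulus (join e f)].
Proof.
rewrite !modulusP /= => /and3P[e1 e2 e3] /and3P[f1 f2 f3].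
by rewrite /maxn; case: ifP; case: ifP; case: ifP => *; apply/and3P.
Qed.

Definition seven_free : seq expo :=
  [:: (1, 0, 0); (0, 1, 0); (2, 0, 0); (1, 1, 0); (3, 0, 0); (0, 2, 0);
      (2, 1, 0); (0, 0, 1); (1, 0, 1); (0, 1, 1)].

(* U is concentrated on the type (K, ws) when it lies in one class modulo K and is
   covered by one class for each modulus in ws.  A computer search selected these
   types: each is cheap to refute, and every partition of [seven_free] into 6 blocks
   covering U yields one of them. *)
Definition closing_types : seq (expo * seq expo) :=
  [:: ((1, 0, 0), [:: (1, 1, 1); (1, 1, 1)]);
      ((2, 0, 0), [:: (2, 1, 0); (2, 1, 1)]);
      ((1, 1, 0), [:: (2, 1, 0); (1, 2, 0)]);
      ((1, 1, 0), [:: (1, 1, 1); (2, 1, 0)]);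
      ((2, 0, 0), [:: (2, 0, 1); (2, 1, 1)]);
      ((2, 0, 0), [:: (3, 0, 0); (2, 1, 1)]);
      ((1, 0, 0), [:: (1, 1, 1); (3, 0, 1)]);
      ((1, 1, 0), [:: (1, 1, 1); (1, 2, 0)]);
      ((0, 1, 0), [:: (0, 1, 1)]);
      ((0, 2, 0), [:: (0, 2, 1); (1, 2, 0)])].

Definition dividesb (e f : expo) : bool :=
  if leqb e.1.1 f.1.1 then if leqb e.1.2 f.1.2 then leqb e.2 f.2 else false
  else false.

(** A class modulo [v] lies in a class modulo each divisor [w] of [v], so a type may be coarser than
    the block that it captures. The two progressions of a block may be matched in either order. *)
Definition embeds (vs ws : seq expo) : bool :=
  match vs, ws with
  | [:: v], _ => hasb (fun w => dividesb w v) ws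
  | [:: v1; v2], [:: w1; w2] =>
      if (if dividesb w1 v1 then dividesb w2 v2 else false) then true
      else if dividesb w1 v2 then dividesb w2 v1 else false
  | _, _ => false
  end.

(* If each block of bs covers U, the blocks with a single progression confine U to
   one class modulo their common multiple. *)
Definition common (bs : seq (seq expo)) : expo :=
  foldr (fun b N => if b is [:: e] then join e N else N) (0, 0, 0) bs.

Definition closed_by (N : expo) (vss : seq (seq expo)) (t : expo * seq expo) : bool :=
  if dividesb t.1 N then hasb (embeds^~ t.2) vss else false.

Fixpoint insertions (e : expo) (bs : seq (seq expo)) : seq (seq (seq expo)) :=
  if bs is b :: bs' then
    ((e :: b) :: bs') :: [seq b :: c | c <- insertions e bs']
  else [::].

(** Each block covers U by itself, so one block of at most two progressions, refined modulo [N], is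
    enough to recognise a type. *)
Definition closes (bs : seq (seq expo)) : bool :=
  let N := common bs in
  let vss := [seq [seq join N e | e <- b] | b <- bs & leqb (size b) 2] in
  hasb (closed_by N vss) closing_types.

(* Runs through the partitions of es into 6 blocks, one for each residue modulo 7
   that remains once the modulus 7 is used. *)
Fixpoint all_closed (es : seq expo) (bs : seq (seq expo)) : bool :=
  (* Six nonempty blocks are out of reach, so some residue modulo 7 would have no progression at
     all. *)
  if leqb (size bs + size es) 5 then true else
  if es is e :: es' then
    if leqb (size bs) 5 then
      if all_closed es' ([:: e] :: bs) then
        allb (all_closed es') (insertions e bs)
      else false
    else allb (all_closed es') (insertions e bs)
  else closes bs.

Lemma seven_free_closed : all_closed seven_free [::].
Proof. by vm_compute. Qed.

Lemma dividesbE e f : dividesb e f = divides e f.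
Proof. by rewrite /dividesb !leqbE /divides; do 2?case: ifP. Qed.

Section Closing.
Variables (U : pred nat) (rho : expo -> nat).

Definition in_block (b : seq expo) (x : nat) : bool :=
  has (fun e => x == rho e %[mod modulus e]) b.

(** Centres in U are congruent modulo the first component of the type; the masks of the search rely
    on it. *)
Definition concentrated (t : expo * seq expo) : Prop :=
  (forall x y, U x -> U y -> x == y %[mod modulus t.1]) /\
  exists2 cs, size cs = size t.2 /\ all U cs &
    forall x, U x -> has (fun wc => x == wc.2 %[mod modulus wc.1]) (zip t.2 cs).

Lemma common_eq bs x y : (forall b z, b \in bs -> U z -> in_block b z) ->
  U x -> U y -> x == y %[mod modulus (common bs)].
Proof.
move=> cov Ux Uy; elim: bs cov => [|b bs IH] cov; first by rewrite /= !modn1.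
have {}IH : x == y %[mod modulus (common bs)].
  by apply: IH => b' z b'in; apply: cov; rewrite inE b'in orbT.
rewrite /=; case: b cov => [|e [|f b]] cov //.
apply: modulus_join _ IH.
have := cov [:: e] x (mem_head _ _) Ux; have := cov [:: e] y (mem_head _ _) Uy.
by rewrite /in_block /= !orbF => /eqP-> /eqP->.
Qed.

(* A class that misses U can be replaced by the class of any element of U. *)
Lemma class_center b v e : U b -> exists2 c, U c &
  forall x, U x -> x == v %[mod modulus e] -> x == c %[mod modulus e].
Proof.
move=> Ub; case: (classic (exists2 c, U c & c == v %[mod modulus e])).
  by case=> c Uc /eqP cv; exists c => // x _ xv; rewrite cv.
by move=> none; exists b => // x Ux xv; case: none; exists x.
Qed.

Lemma divides_cong w v x y : divides w v -> x == y %[mod modulus v] ->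
  x == y %[mod modulus w].
Proof. by move=> /modulus_dvd; apply: eqn_mod_dvdl. Qed.

Lemma embeds_concentrated b0 N vs t : U b0 ->
  (forall x y, U x -> U y -> x == y %[mod modulus N]) -> divides t.1 N ->
  embeds [seq join N e | e <- vs] t.2 -> (forall x, U x -> in_block vs x) ->
  concentrated t.
Proof.
case: t => K ws /= Ub cong KN emb cov; split=> [x y Ux Uy|].
  exact: divides_cong KN (cong x y Ux Uy).
have center e : exists2 c, U c & forall x, U x -> x == rho e %[mod modulus e] ->
    x == c %[mod modulus (join N e)].
  have [c Uc h] := class_center (rho e) e Ub; exists c => // x Ux xe.
  by apply: modulus_join; [apply: cong|apply: h].
case: vs emb cov => [|v1 [|v2 [|v3 vs]]] //=.
  rewrite hasbE => /hasP[w w_in]; rewrite dividesbE => wv cov.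
  (* A single modulus of [ws] does the covering; the same centre fills the other places. *)
  have [c Uc hc] := center v1; exists (nseq (size ws) c).
    by rewrite size_nseq; split=> //; apply/allP => u /nseqP[->].
  move=> x Ux; have := cov x Ux; rewrite /in_block /= orbF => /(hc x Ux) h.
  elim: ws w_in => //= u ws IH; rewrite inE => /orP[/eqP <-|/IH->]; last by rewrite orbT.
  by rewrite (divides_cong wv h).
case: ws => [|w1 [|w2 [|w3 ws]]] //; rewrite !dividesbE => emb cov.
have [c1 Uc1 h1] := center v1; have [c2 Uc2 h2] := center v2.
have cov' x : U x -> (x == c1 %[mod modulus (join N v1)]) ||
    (x == c2 %[mod modulus (join N v2)]).
  move=> Ux; have := cov x Ux; rewrite /in_block /= orbF => /orP[/h1|/h2] -> //.
  by rewrite orbT.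
have {emb} : divides w1 (join N v1) && divides w2 (join N v2) ||
    divides w1 (join N v2) && divides w2 (join N v1).
  by move: emb; do 4?case: (divides _ _).
case/orP=> /andP[d1 d2].
  exists [:: c1; c2]; first by rewrite /= Uc1 Uc2.
  by move=> x /cov' /orP[] h /=; rewrite ?(divides_cong d1 h) ?(divides_cong d2 h) ?orbT.
exists [:: c2; c1]; first by rewrite /= Uc1 Uc2.
by move=> x /cov' /orP[] h /=; rewrite ?(divides_cong d1 h) ?(divides_cong d2 h) ?orbT.
Qed.

Lemma closed_concentrated b0 bs : U b0 -> closes bs ->
  (forall b x, b \in bs -> U x -> in_block b x) ->
  exists2 t, t \in closing_types & concentrated t.
Proof.
move=> Ub; rewrite /closes hasbE => /hasP[t t_in]; rewrite /closed_by dividesbE.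
case: ifP => // tN; rewrite hasbE => /hasP[_ /mapP[b + ->] emb] cov.
rewrite mem_filter => /andP[_ b_in]; exists t => //.
apply: (embeds_concentrated Ub _ tN emb) => x; last exact: cov.
by move=> y; apply: common_eq.
Qed.

Variables (col : expo -> nat) (es0 : seq expo) (cs : seq nat).
Hypotheses (cs_uniq : uniq cs) (size_cs : size cs = 6).
Hypothesis es0_col : forall e, e \in es0 -> col e \in cs.
Hypothesis columns : forall c x, c \in cs -> U x ->
  in_block [seq e <- es0 | col e == c] x.

Definition blocks (done : seq expo) (ds : seq nat) : seq (seq expo) :=
  [seq [seq e <- done | col e == d] | d <- ds].

Lemma insertions_blocks e done ds : uniq ds -> col e \in ds ->
  blocks (e :: done) ds \in insertions e (blocks done ds).
Proof.
elim: ds => //= d ds IH /andP[d_nin ds_uniq].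
rewrite inE; case: (eqVneq (col e) d) => [ed _|ne /= e_in].
  rewrite inE; apply/orP; left; apply/eqP; congr (_ :: _).
  apply/eq_in_map => d' d'_in /=; case: eqP => // ed'.
  by move: d_nin; rewrite -ed ed' d'_in.
by rewrite inE; apply/orP; right; apply: map_f; apply: IH.
Qed.

(** Follows the branch of the search given by the actual columns: [done] lists the progressions
    already distributed, [ds] the columns opened for them. As U contains [b0], no column stays
    empty. *)
Lemma all_closed_sound b0 es done ds : U b0 -> uniq ds -> {subset ds <= cs} ->
  (forall e, e \in done -> col e \in ds) ->
  (forall e, e \in es0 -> (e \in es) || (e \in done)) -> {subset es <= es0} ->
  {subset done <= es0} ->
  all_closed es (blocks done ds) ->
  exists2 t, t \in closing_types & concentrated t.
Proof.
move=> Ub; elim: es done ds => [|e es IH] done ds ds_uniq ds_cs done_ds es0E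
  es_sub done_sub.
  have blockE d x : d \in cs -> U x -> in_block [seq e <- done | col e == d] x.
    move=> d_in Ux; have /hasP[e] := columns d_in Ux.
    rewrite mem_filter => /andP[ed /es0E /= e_in] xe; apply/hasP; exists e => //.
    by rewrite mem_filter ed.
  have ds6 : 6 <= size ds.
    rewrite -size_cs uniq_leq_size // => d d_in.
    have /hasP[e] := blockE d b0 d_in Ub; rewrite mem_filter => /andP[/eqP <- e_in] _.
    exact: done_ds.
  rewrite /= size_map addn0 leqbE leqNgt ds6 /= => cl.
  apply: (closed_concentrated Ub cl) => _ x /mapP[d d_in ->].
  by apply: blockE; apply: ds_cs.
have e_cs : col e \in cs by apply: es0_col; apply: es_sub; rewrite mem_head.
have e_es0 : e \in es0 by apply: es_sub; rewrite mem_head.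
have es_sub' : {subset es <= es0} by move=> f f_in; apply: es_sub; rewrite inE f_in orbT.
have done_sub' : {subset e :: done <= es0}.
  by move=> f; rewrite inE => /predU1P[->|/done_sub].
have es0E' f : f \in es0 -> (f \in es) || (f \in e :: done).
  by move/es0E; rewrite !inE orbCA orbA.
have size_ge : 6 <= size ds + size (e :: es).
  rewrite -size_cs -(size_map col (e :: es)) -size_cat uniq_leq_size // => c c_in.
  have /hasP[f] := columns c_in Ub; rewrite mem_filter mem_cat => /andP[/eqP <- f_in] _.
  by case/orP: (es0E f f_in) => [/(map_f col)->|/done_ds->]; rewrite ?orbT.
rewrite /= size_map !leqbE leqNgt size_ge /=.
case: (boolP (col e \in ds)) => [e_in|e_nin].
  move=> h; have {h} : allb (all_closed es) (insertions e (blocks done ds)).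
    by move: h; case: ifP => //; case: ifP.
  rewrite allbE => /allP /(_ _ (insertions_blocks done ds_uniq e_in)).
  apply: IH => // f; rewrite inE => /predU1P[->//|]; exact: done_ds.
have ds_lt : size ds < 6.
  rewrite -size_cs -[(size ds).+1]/(size (col e :: ds)) uniq_leq_size //= ?e_nin //.
  by move=> d; rewrite inE => /predU1P[->|/ds_cs].
rewrite -ltnS ds_lt; case: ifP => // cl _; move: cl.
have -> : [:: e] :: blocks done ds = blocks (e :: done) (col e :: ds).
  rewrite /blocks /= eqxx; congr (_ :: _).
    congr (_ :: _); symmetry; apply/eqP; rewrite -[_ == _]negbK -has_filter.
    apply/negP => /hasP[f /done_ds f_in /eqP fe]; by rewrite fe (negbTE e_nin) in f_in.
  apply/eq_in_map => d d_in /=; case: eqP => // ed.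
  by rewrite ed d_in in e_nin.
apply: IH => //.
- by rewrite /= e_nin.
- by move=> d; rewrite inE => /predU1P[->|/ds_cs].
- by move=> f; rewrite !inE => /predU1P[->|/done_ds->]; rewrite ?eqxx ?orbT.
Qed.
End Closing.

(** * Replacing the multiples of 16 by coarser classes *)

Section Merge.
Variable r : nat -> nat.
Hypothesis cov : covers r (light ++ sevens ++ [:: 16; 48; 80; 32; 96]).

Definition heavy (x : nat) : bool := ~~ has (in_class r x) (light ++ sevens).

Lemma has_shift (S : seq nat) x t : all (dvdn^~ t) S ->
  has (in_class r (x + t)) S = has (in_class r x) S.
Proof.
by elim: S => //= m S IH /andP[mt /IH->]; rewrite (in_class_shift _ _ mt).
Qed.

(* The other moduli divide 5040, which is 16 modulo 32: of x and x + 5040, one is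
   outside the class modulo 32, hence in the class modulo 96; and 48 divides 5040. *)
Lemma merge32 x : heavy x ->
  [|| in_class r x 16, in_class r x 48, in_class r x 80 | x == r 96 %[mod 48]].
Proof.
rewrite /heavy => hx; apply/negPn/negP; rewrite !negb_or => /and4P[n16 n48 n80 n96].
have miss y : y = x \/ y = x + 5040 -> in_class r y 32 || in_class r y 96.
  move=> yE; have := cov y; rewrite catA has_cat.
  have -> : has (in_class r y) (light ++ sevens) = false.
    by case: yE => ->; rewrite ?has_shift //; apply: negbTE.
  have shift m : m %| 5040 -> in_class r y m = in_class r x m.
    by move=> m_dvd; case: yE => -> //; apply: in_class_shift.
  rewrite /= (shift 16) // (shift 48) // (shift 80) //.
  by rewrite (negbTE n16) (negbTE n48) (negbTE n80) /= orbF.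
have to48 y : in_class r y 96 -> y == r 96 %[mod 48] by apply: eqn_mod_dvdl.
have /orP[x32|/to48 x96] := miss x (or_introl erefl); last by rewrite x96 in n96.
have /orP[y32|/to48] := miss _ (or_intror erefl); last first.
  by rewrite -[_ + 5040]addnC -modnDml addnC addn0 (negbTE n96).
by move: x32 y32; rewrite /in_class => /eqP <-; rewrite -{2}[x]addn0 eqn_modDl.
Qed.

(* 2520 is 8 modulo 16, so no class modulo a multiple of 16 contains both x and
   x + 2520, and two different classes must be used. *)
Lemma merge16 x : heavy x ->
  [|| in_class r x 16, in_class r x 48, in_class r x 80 | x == r 96 %[mod 48]] &&
  [|| in_class r (x + 2520) 16, in_class r (x + 2520) 48, in_class r (x + 2520) 80
    | x + 2520 == r 96 %[mod 48]].
Proof. by move=> hx; rewrite !merge32 // /heavy has_shift. Qed.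

Definition pinned (x : nat) : bool :=
  (x == r 16 %[mod 8]) &&
  [|| x == r 48 %[mod 24], x == r 96 %[mod 24] | x == r 80 %[mod 40]].

Definition paired (c x : nat) : bool :=
  (x == c %[mod 24]) || (x == r 80 %[mod 40]).

(** [x] and [x + 2520] agree modulo 24 and 40 but lie in two different classes among those of 16,
    48, 80 and the halved 96. If the classes of 48 and 96 agree with that of 16 modulo 8, every such
    pair pins [x]. Otherwise at most one of them meets the class modulo 16; with [c] taken from that
    one, or from 48 if there is none, every possible pair involves [c] or 80. *)
Lemma heavy_cases : (forall x, heavy x -> pinned x) \/
  exists c, forall x, heavy x -> paired c x.
Proof.
case: (boolP ((r 48 == r 16 %[mod 8]) && (r 96 == r 16 %[mod 8]))) => [eqs|neq].
  left=> x /merge16; move: eqs; rewrite /pinned /in_class; clear; lia.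
right; exists (if r 48 == r 16 %[mod 8] then r 48 else
               if r 96 == r 16 %[mod 8] then r 96 else r 48) => x /merge16.
move: neq; rewrite /paired /in_class; clear.
case: ifP => [?|?]; last case: ifP => [?|?]; lia.
Qed.

End Merge.

(** * The uncovered set U and its columns modulo 7 *)

Definition gap (r : nat -> nat) (Q : pred nat) (x : nat) : bool :=
  ~~ has (in_class r x) light && ~~ Q x.

Section Columns.
Variables (r : nat -> nat) (Q : pred nat).
Hypothesis Q_heavy : forall x, heavy r x -> Q x.
Hypothesis Q_periodic : forall x t, Q (x + 360 * t) = Q x.
Let U := gap r Q.

Definition rho (e : expo) : nat := r (7 * modulus e).

(* Moduli 7 d sharing the residue of the class modulo 7 are useless; they are put
   in an arbitrary other column. *)
Definition column (e : expo) : nat :=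
  if rho e == r 7 %[mod 7] then (r 7).+1 %% 7 else rho e %% 7.

Definition columns : seq nat := [seq s <- iota 0 7 | s != r 7 %% 7].

Lemma size_columns : size columns = 6.
Proof.
have : r 7 %% 7 < 7 by rewrite ltn_mod.
by rewrite /columns; move: (r 7 %% 7); do 7?[case=> //].
Qed.

Lemma column_in e : column e \in columns.
Proof.
rewrite mem_filter mem_iota /= /column; case: ifP => [_|/negbT ne].
  by rewrite ltn_mod andbT -addn1 -{2}[r 7]addn0 eqn_modDl.
by rewrite ne ltn_mod.
Qed.

(** This is why [Q] stands in for [heavy], which also depends on residues modulo 7: U becomes a
    union of classes modulo 360, a number prime to 7. *)
Lemma gap_periodic x t : U (x + 360 * t) = U x.
Proof.
rewrite /U /gap Q_periodic has_shift //; apply/allP => m m_in; apply: dvdn_mulr.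
by move: m m_in; apply/allP; vm_compute.
Qed.

Lemma column_cover s x : s \in columns -> U x ->
  in_block rho [seq e <- seven_free | column e == s] x.
Proof.
rewrite mem_filter mem_iota /= => /andP[ne lt_s] Ux.
(* 5 inverts 360 modulo 7 and 6 is -1, hence [y] is [s] modulo 7 and [x] modulo 360. *)
pose y := x + 360 * (5 * (s + 6 * x)).
have ys : y %% 7 = s by rewrite /y; move: lt_s; clear; lia.
have Uy : U y by rewrite gap_periodic.
have : has (in_class r y) sevens.
  case/andP: Uy => nl nQ; apply: contraR nQ => n7.
  by rewrite Q_heavy // /heavy has_cat negb_or nl.
have -> : sevens = 7 :: [seq 7 * modulus e | e <- seven_free] by [].
case/hasP=> m; rewrite in_cons => /orP[/eqP-> | /mapP[e e_in ->] ye].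
  by rewrite /in_class ys (negbTE ne).
have e_dvd : modulus e %| 360 by move: e e_in {ye}; apply/allP; vm_compute.
have e_s : rho e %% 7 = s.
  by rewrite -ys; apply/esym/eqP; apply: eqn_mod_dvdl ye; apply: dvdn_mulr.
have e_blk : e \in [seq e <- seven_free | column e == s].
  by rewrite mem_filter e_in /column e_s (negbTE ne) eqxx.
apply/hasP; exists e => //.
have: y == rho e %[mod modulus e] by apply: eqn_mod_dvdl ye; apply: dvdn_mull.
by rewrite -(@modn_dvdm 360 y) // /y mulnC [x + _]addnC modnMDl modn_dvdm.
Qed.

Lemma gap_concentrated b : U b -> exists2 t, t \in closing_types & concentrated U t.
Proof.
move=> Ub; apply: (@all_closed_sound U rho column seven_free columns _ _ _ _ b
  seven_free [::] [::] _ _ _ _ _ _ _ seven_free_closed) => //.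
- by rewrite filter_uniq ?iota_uniq.
- exact: size_columns.
- by move=> e _; apply: column_in.
- exact: column_cover.
- by move=> e e_in; apply/orP; left.
Qed.

Lemma gap_classes : exists b t cs, [/\ t \in closing_types, size cs = size t.2,
  all (fun c => c == b %[mod modulus t.1]) cs &
  forall x, U x -> has (fun wc => x == wc.2 %[mod modulus wc.1]) (zip t.2 cs)].
Proof.
case: (classic (exists b, U b)) => [[b Ub]|none].
  have [t t_in [cong [cs [sz csU] cov]]] := gap_concentrated Ub.
  exists b, t, cs; split=> //; apply/allP => c /(allP csU) Uc; exact: cong.
(* When U is empty any closing type will do; this one needs a single centre. *)
exists 0, ((0, 1, 0), [:: (0, 1, 1)]), [:: 0]; split=> // x Ux.
by case: none; exists x.
Qed.
End Columns.

(** * Application of the search to the full grid *)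

Lemma In_filter (T : Type) (p : pred T) s x :
  List.In x (filter p s) -> List.In x s /\ p x.
Proof.
elim: s => //= y s IH; case: ifP => [py|_] /=.
  by case=> [<-|/IH[? ?]]; split=> //; [left|right].
by case/IH=> ? ?; split=> //; right.
Qed.

Lemma swaps_ok s : List.In s swaps -> swap_ok s.
Proof.
have conv (P : swap -> Prop) (Pb : pred swap) l :
    (forall s, List.In s l -> Pb s -> P s) -> all Pb l -> forall s, List.In s l -> P s.
  elim: l => //= u l IH h /andP[Pu Pl] v [<-|v_in]; first by apply: h => //; left.
  by apply: IH => // w w_in; apply: h; right.
apply: (conv _ swap_okb) => [u|]; last by vm_compute.
rewrite /swaps /= => u_in; do 20?[case: u_in => [<-|u_in]; first exact: exchange_ok].
by case: u_in.
Qed.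

Lemma full_rowsE r x : r < 4 -> x < 72 -> entry full_rows r x = 1.
Proof.
by move=> lt_r lt_x; rewrite /entry /full_rows nth_nseq lt_r nth_nseq lt_x.
Qed.

Lemma total_full_rows : total full_rows = 288.
Proof.
rewrite /total /weight big_nat (eq_bigr (fun _ => 72)) => [|r /= lt_r].
  by rewrite -big_nat big_const_nat.
rewrite big_nat (eq_bigr (fun _ => 1)) => [|x /= lt_x]; last by rewrite full_rowsE.
by rewrite -big_nat big_const_nat.
Qed.

Lemma refuted_sound els : all piece_ok els -> refuted els ->
  ~ coverable 4 (fun _ _ => true) els.
Proof.
move=> els_ok; rewrite /refuted; set bs := map _ els.
have bsE : bs = map bound_of (map (info_of (map class_sums full_rows)) els).
  by rewrite -map_comp.
move=> ref cov; apply: (refute_sound _ _ els_ok _ _ _ ref) => //.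
- by rewrite bsE; apply: info_valid.
- rewrite total_full_rows -/(sumn bs); move: (sumn bs); clear; lia.
- move=> s s_in; have [s_in' cmp] : List.In s swaps /\ all (compatible^~ s) els.
    exact: In_filter s_in.
  have sok := swaps_ok s_in'; split=> // r x lt_r lt_x.
  by rewrite !full_rowsE // (swap_lt sok).
apply: coverable_ext cov => r x lt_r lt_x.
by rewrite /uncovered full_rowsE.
Qed.

(** * The grid of residues modulo 5 and 72 *)

Definition row_modulus (d : nat) : nat := if 5 %| d then d %/ 5 else d.

Definition piece_of (K d : nat) (two : bool) : piece :=
  mk_piece (if 5 %| d then OneRow else AllRows) K (row_modulus d) two.

Lemma mk_piece_mod k K m two : m \in moduli -> piece_mod (mk_piece k K m two) = m.
Proof. by move=> m_in; rewrite /piece_mod nth_index. Qed.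

Section Grid.
Variables (b r0 : nat).

(* 145 = (1 mod 72, 0 mod 5) and 216 = (0 mod 72, 1 mod 5): row j is the residue
   class of r0 + 1 + j modulo 5, so that the class of r0 is the absent fifth row. *)
Definition point (j x : nat) : nat := 145 * (b + x) + 216 * (r0 + 1 + j).

(* Row 0 is a harmless default for a class that only meets the absent row. *)
Definition row_of (c : nat) : nat :=
  let g := (c + 4 * (r0 + 1)) %% 5 in if g < 4 then g else 0.

(** 71 is -1 modulo 72: a class [c] becomes [c - b] because [point] counts from [b]. Likewise 4 is
    -1 modulo 5 in [row_of]. *)
Definition position (d c : nat) : nat * nat :=
  (if 5 %| d then row_of c else 0, (c + 71 * b) %% row_modulus d).

Lemma row_of_lt c : row_of c < 4.
Proof. by rewrite /row_of; case: ifP. Qed.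

Lemma row_ofE j x c : j < 4 -> point j x == c %[mod 5] -> j == row_of c.
Proof. by rewrite /point /row_of => lt_j; case: ifP; move: lt_j; clear; lia. Qed.

Lemma point_mod72 j x : point j x = b + x %[mod 72].
Proof. by rewrite /point; clear; lia. Qed.

Lemma point_residue m j x c : m %| 72 -> point j x == c %[mod m] ->
  x %% m == (c + 71 * b) %% m.
Proof.
move=> m_dvd; rewrite -(modn_dvdm (point j x) m_dvd) point_mod72 modn_dvdm // => h.
rewrite -(eqn_modDl b) (eqP h) (_ : b + (c + 71 * b) = 72 * b + c); last by clear; lia.
by rewrite -(modnDml (72 * b)) (eqP (dvdn_mulr b m_dvd)).
Qed.

Lemma moduli_dvd m : m \in moduli -> m %| 72.
Proof. by move: m; apply/allP; vm_compute. Qed.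

Lemma hit_position K d two c j x : row_modulus d \in moduli -> j < 4 ->
  point j x == c %[mod d] -> hit (piece_of K d two) (position d c) j x.
Proof.
move=> d_in lt_j; rewrite /hit /position /piece_of mk_piece_mod //=.
move: d_in; rewrite /row_modulus; case: ifP => [d5|_] /moduli_dvd d_dvd h.
  have h' : point j x == c %[mod d %/ 5].
    by apply: eqn_mod_dvdl h; rewrite -{2}(divnK d5) dvdn_mulr.
  by rewrite (point_residue d_dvd h') andbT (row_ofE lt_j (eqn_mod_dvdl d5 h)).
exact: point_residue h.
Qed.

Lemma residue_multiple K m c : K %| m -> m %| 72 -> c == b %[mod K] ->
  (c + 71 * b) %% m %% K = 0.
Proof.
move=> Km m72 /eqP cb; rewrite modn_dvdm // -modnDml cb modnDml -mulSn.
by apply/eqP; apply: dvdn_mulr; apply: dvdn_trans Km m72.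
Qed.

Lemma position_okP K d two c : row_modulus d \in moduli -> K %| row_modulus d ->
  c == b %[mod K] -> position_ok 4 (piece_of K d two) (position d c).
Proof.
move=> d_in K_dvd cb; have d72 := moduli_dvd d_in.
have lt_m : (c + 71 * b) %% row_modulus d < row_modulus d.
  by rewrite ltn_mod (dvdn_gt0 _ d72).
rewrite /position_ok /position /piece_of mk_piece_mod //= lt_m /=; apply/andP; split.
  by case: ifP; rewrite ?row_of_lt.
rewrite /allowed /=; case: ifP => //= _.
by rewrite (nth_map 0) ?size_iota // nth_iota // add0n residue_multiple.
Qed.

(* 9 c + 16 t is c modulo 8 and t modulo 3. *)
Definition split_position (c t h : nat) : nat * nat :=
  (row_of h, (9 * c + 16 * t + 71 * b) %% 24).

Lemma hit_split c t h j x : j < 4 -> point j x == c %[mod 8] ->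
  (point j x == h %[mod 5]) || (point j x != t %[mod 3]) ->
  hit (mk_piece Split 1 24 false) (split_position c t h) j x.
Proof.
move=> lt_j hc ht; rewrite /hit /= (@modn_dvdm 24 _ 8) //.
have hc' : point j x == 9 * c + 16 * t %[mod 8].
  by rewrite (eqP hc); clear; lia.
rewrite (point_residue _ hc') //=.
case/orP: ht => [/(row_ofE lt_j)->//|ht]; apply/orP; right.
apply: contra ht => /eqP hx; move: hx; rewrite -[_ %% 24]/(_ %% 24).
have := point_mod72 j x; clear; lia.
Qed.

End Grid.

Definition located (b r0 K d : nat) (cs : seq nat) : piece * seq (nat * nat) :=
  (piece_of K d (size cs == 2), [seq position b r0 d c | c <- cs]).

Definition located_hit (j x : nat) (ep : piece * seq (nat * nat)) : bool :=
  has (fun p => hit ep.1 p j x) ep.2.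

Lemma located_hitP b r0 K d cs c j x : row_modulus d \in moduli -> j < 4 ->
  c \in cs -> point b r0 j x == c %[mod d] -> located_hit j x (located b r0 K d cs).
Proof.
move=> d_in lt_j c_in h; apply/hasP; exists (position b r0 d c); first exact: map_f.
exact: hit_position.
Qed.

Lemma located_ok b r0 K d cs : row_modulus d \in moduli -> K %| row_modulus d ->
  0 < size cs <= 2 -> all (fun c => c == b %[mod K]) cs ->
  choice_ok 4 (located b r0 K d cs).1 (located b r0 K d cs).2.
Proof.
move=> d_in Kd szs csb; rewrite /choice_ok /= size_map; apply/andP; split.
  by move: szs; case: (size cs) => [|[|[|]]].
by apply/allP => _ /mapP[c /(allP csb) cb ->]; apply: position_okP.
Qed.

Lemma coverable_located (L : seq (piece * seq (nat * nat))) :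
  all (fun ep => choice_ok 4 ep.1 ep.2) L ->
  (forall j x, j < 4 -> x < 72 -> has (located_hit j x) L) ->
  coverable 4 (fun _ _ => true) (unzip1 L).
Proof.
move=> ok cov; exists (unzip2 L).
by split=> [||r x lt_r lt_x _]; rewrite ?size_map // /hits zip_unzip //; apply: cov.
Qed.

(** Two equal moduli become one piece with two copies, which spares the search their exchange. *)
Definition type_pieces (t : expo * seq expo) : seq piece :=
  let K := modulus t.1 in
  match t.2 with
  | [:: w; v] => if w == v then [:: piece_of K (modulus w) true]
                 else [:: piece_of K (modulus w) false; piece_of K (modulus v) false]
  | ws => [seq piece_of K (modulus w) false | w <- ws]
  end.

Definition type_located b r0 (t : expo * seq expo) (cs : seq nat) :=
  let K := modulus t.1 in
  if t.2 is [:: w; v] then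
    if w == v then [:: located b r0 K (modulus w) cs]
    else [seq located b r0 K (modulus wc.1) [:: wc.2] | wc <- zip t.2 cs]
  else [seq located b r0 K (modulus wc.1) [:: wc.2] | wc <- zip t.2 cs].

Definition grid_moduli : seq nat :=
  [:: 6; 8; 9; 12; 18; 24; 36; 72; 10; 15; 20; 30; 40; 45; 60; 90].

Definition pinned_pieces : seq piece :=
  [seq piece_of 1 d false | d <- grid_moduli] ++ [:: mk_piece Split 1 24 false].

(** [paired] contributes one class modulo 24 and one modulo 40 besides those of the system, hence
    the two copies. *)
Definition paired_pieces : seq piece :=
  [seq piece_of 1 d (d \in [:: 24; 40]) | d <- grid_moduli].

Lemma closing_types_refuted t : t \in closing_types ->
  refuted (type_pieces t ++ pinned_pieces) && refuted (type_pieces t ++ paired_pieces).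
Proof.
by move: t; apply/allP; vm_compute.
Qed.

Arguments located : simpl never.

Definition type_ok (t : expo * seq expo) : bool :=
  [&& 0 < size t.2 <= 2, all piece_ok (type_pieces t) &
    all (fun w => (row_modulus (modulus w) \in moduli) &&
                  (modulus t.1 %| row_modulus (modulus w))) t.2].

Lemma closing_types_ok t : t \in closing_types -> type_ok t.
Proof. by move: t; apply/allP; vm_compute. Qed.

Section TypeLocated.
Variables (b r0 : nat) (t : expo * seq expo) (cs : seq nat).
Hypotheses (tok : type_ok t) (size_cs : size cs = size t.2).
Hypothesis cs_b : all (fun c => c == b %[mod modulus t.1]) cs.

Lemma type_located_pieces : unzip1 (type_located b r0 t cs) = type_pieces t.
Proof.
case/and3P: tok => + _ _; move: size_cs; rewrite /type_located /type_pieces.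
case: t.2 => [|w [|v [|? ?]]] //=; case: cs => [|c [|c' [|? ?]]] //= _ _.
by case: eqP.
Qed.

Lemma type_located_ok :
  all (fun ep => choice_ok 4 ep.1 ep.2) (type_located b r0 t cs).
Proof.
case/and3P: tok => + _; move: size_cs cs_b; rewrite /type_located.
case: t.2 => [|w [|v [|? ?]]] //; case: cs => [|c [|c' [|? ?]]] // _.
  move=> cb _ /andP[/andP[w_in Kw] _]; rewrite /= andbT.
  exact: (@located_ok _ _ _ _ [:: c]).
move=> csb _ /and3P[/andP[w_in Kw] /andP[v_in Kv] _].
case: ifP => _; first by rewrite all_seq1; apply: (@located_ok _ _ _ _ [:: c; c']).
case/and3P: csb => cb cb' _; apply/and3P; split=> //.
  by apply: (@located_ok _ _ _ _ [:: c]); rewrite //= ?cb.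
by apply: (@located_ok _ _ _ _ [:: c']); rewrite //= ?cb'.
Qed.

Lemma type_located_hit j x : j < 4 ->
  has (fun wc => point b r0 j x == wc.2 %[mod modulus wc.1]) (zip t.2 cs) ->
  has (located_hit j x) (type_located b r0 t cs).
Proof.
case/and3P: tok => + _ + lt_j; move: size_cs; rewrite /type_located.
have hit_one w c d : row_modulus (modulus w) \in moduli -> c \in d ->
    point b r0 j x == c %[mod modulus w] ->
    located_hit j x (located b r0 (modulus t.1) (modulus w) d).
  by move=> w_in; apply: located_hitP.
case: t.2 => [|w [|v [|? ?]]] //=; case: cs => [|c [|c' [|? ?]]] //= _ _.
  by rewrite !andbT !orbF => /andP[w_in _]; apply: hit_one; rewrite ?mem_head.
rewrite andbT !orbF => /andP[/andP[w_in _] /andP[v_in _]].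
case: (w =P v) => [wv|_] /=; rewrite ?orbF.
  by case/orP=> h; [|rewrite wv]; apply: hit_one h => //; rewrite !inE eqxx ?orbT.
by case/orP=> h; apply/orP; [left|right]; apply: hit_one h; rewrite // mem_head.
Qed.
End TypeLocated.

(** * Contradiction from the grid, for both forms of the merged classes *)

Section Contradiction.
Variables (r : nat -> nat) (Q : pred nat) (pcs : seq piece).
Variable base : nat -> seq (piece * seq (nat * nat)).
Hypothesis Q_heavy : forall x, heavy r x -> Q x.
Hypothesis Q_periodic : forall x t, Q (x + 360 * t) = Q x.
Hypothesis base_pieces : forall b, unzip1 (base b) = pcs.
Hypothesis base_ok : forall b, all (fun ep => choice_ok 4 ep.1 ep.2) (base b).
Hypothesis base_hit : forall b j x (y := point b (r 5) j x), j < 4 ->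
  has (in_class r y) grid_moduli || Q y -> has (located_hit j x) (base b).
Hypothesis pcs_ok : all piece_ok pcs.
Hypothesis pcs_refuted : forall t, t \in closing_types -> refuted (type_pieces t ++ pcs).

Lemma light_grid b j x (y := point b (r 5) j x) : j < 4 ->
  has (in_class r y) light -> has (in_class r y) grid_moduli.
Proof.
move=> lt_j /hasP[m m_in ym]; apply/hasP; exists m => //.
suff m5 : m != 5 by move: m_in m5; rewrite !inE; do 16?[case: (m =P _) => //= _].
apply: contraTN ym => /eqP ->; rewrite /in_class /y /point; move: lt_j; clear; lia.
Qed.

Lemma grid_contradiction : False.
Proof.
have [b [t [cs [t_in sz_cs cs_b cov]]]] := gap_classes Q_heavy Q_periodic.
have tok := closing_types_ok t_in; have /and3P[_ t_ok _] := tok.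
apply: (refuted_sound _ (pcs_refuted t_in)); first by rewrite all_cat t_ok.
rewrite -(base_pieces b) -(type_located_pieces b (r 5) tok sz_cs) -map_cat.
apply: coverable_located => [|j x lt_j lt_x].
  by rewrite all_cat base_ok type_located_ok.
rewrite has_cat; case: (boolP (gap r Q (point b (r 5) j x))) => [/cov h|].
  by rewrite type_located_hit.
rewrite /gap negb_and !negbK => h; rewrite base_hit ?orbT //.
by case/orP: h => [/(light_grid lt_j)->//|->]; rewrite orbT.
Qed.

End Contradiction.

Lemma pinned_periodic r x t : pinned r (x + 360 * t) = pinned r x.
Proof. by rewrite /pinned; congr (_ && [|| _, _ | _]); clear; lia. Qed.

Lemma paired_periodic r c x t : paired r c (x + 360 * t) = paired r c x.
Proof. by rewrite /paired; congr (_ || _); clear; lia. Qed.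

Lemma grid_moduli_ok d : d \in grid_moduli -> row_modulus d \in moduli.
Proof. by move: d; apply/allP; vm_compute. Qed.

Definition grid_pieces b r0 (cls : nat -> seq nat) :=
  [seq located b r0 1 d (cls d) | d <- grid_moduli].

Lemma grid_pieces_ok b r0 cls : (forall d, 0 < size (cls d) <= 2) ->
  all (fun ep => choice_ok 4 ep.1 ep.2) (grid_pieces b r0 cls).
Proof.
move=> sz; rewrite all_map; apply/allP => d d_in.
apply: located_ok => //; first exact: grid_moduli_ok.
by apply/allP => c _; rewrite !modn1.
Qed.

Lemma grid_pieces_hit b r0 cls d c j x : d \in grid_moduli -> c \in cls d -> j < 4 ->
  point b r0 j x == c %[mod d] -> has (located_hit j x) (grid_pieces b r0 cls).
Proof.
move=> d_in c_in lt_j h; rewrite has_map; apply/hasP; exists d => //.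
by apply: located_hitP h; rewrite ?grid_moduli_ok.
Qed.

(** Supplies the exceptional third of the [Split] piece: the part of the class modulo 8 in [pinned]
    that the classes modulo 24 miss, so that only the class modulo 40, within one row, can reach
    it. *)
Lemma free_third a b : exists2 t, a != t %[mod 3] & b != t %[mod 3].
Proof.
have: exists t, (a != t %[mod 3]) && (b != t %[mod 3]); last by case=> t /andP[]; exists t.
case: (boolP ((a != 0 %[mod 3]) && (b != 0 %[mod 3]))) => [|h0]; first by exists 0.
case: (boolP ((a != 1 %[mod 3]) && (b != 1 %[mod 3]))) => [|h1]; first by exists 1.
by exists 2; move: h0 h1; clear; lia.
Qed.

Lemma no_cover r : ~ covers r (iota 5 103).
Proof.
move=> /covers_smooth cov; case: (heavy_cases cov) => [Q_heavy|[c Q_heavy]].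
  have [t t48 t96] := free_third (r 48) (r 96).
  apply: (grid_contradiction (pcs := pinned_pieces) (base := fun b =>
    grid_pieces b (r 5) (fun d => [:: r d]) ++
    [:: (mk_piece Split 1 24 false, [:: split_position b (r 5) (r 16) t (r 80)])])
    Q_heavy (pinned_periodic r)) => //.
  - move=> b; rewrite all_cat grid_pieces_ok // /= /choice_ok /= /position_ok /=.
    by rewrite row_of_lt ltn_mod.
  - move=> b j x y lt_j; rewrite has_cat => /orP[/hasP[d d_in yd]|].
      by rewrite (grid_pieces_hit d_in _ lt_j yd) // mem_head.
    case/andP=> y8 y_or; apply/orP; right; rewrite /located_hit /= !orbF.
    apply: hit_split => //.
    move: y_or t48 t96; rewrite -/y; move: (y) (r 48) (r 96) (r 80); clear; lia.
  by move=> t' /closing_types_refuted/andP[].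
apply: (grid_contradiction (pcs := paired_pieces) (base := fun b =>
  grid_pieces b (r 5) (fun d => if d == 24 then [:: r 24; c] else
    if d == 40 then [:: r 40; r 80] else [:: r d])) Q_heavy (paired_periodic r c)) => //.
- by move=> b; apply: grid_pieces_ok => d; do 2?case: ifP.
- move=> b j x y lt_j /orP[/hasP[d d_in yd]|/orP[yc|yc]].
  + apply: (grid_pieces_hit d_in _ lt_j yd).
    by case: eqP => [->|_]; [|case: eqP => [->|_]]; rewrite !inE eqxx.
  + by apply: (grid_pieces_hit (d := 24) _ _ lt_j yc); rewrite // !inE eqxx orbT.
  by apply: (grid_pieces_hit (d := 40) _ _ lt_j yc); rewrite // !inE eqxx orbT.
by move=> t' /closing_types_refuted/andP[].
Qed.

(** Moduli absent from the system get the class 0: extra progressions preserve a covering, so all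
    the moduli from 5 to 107 can be assumed present. *)
Definition residue n (a : 'I_n -> int) (m : 'I_n -> nat) (k : nat) : nat :=
  if [pick i | m i == k] is Some i then absz (modz (a i) (m i)) else 0.

Lemma residue_class n (a : 'I_n -> int) (m : 'I_n -> nat) i x :
  distinct_moduli m -> 0 < m i -> arith_prog (a i) (m i) (Posz x) ->
  in_class (residue a m) x (m i).
Proof.
move=> hdist mi_gt0 [k xE]; rewrite /in_class /residue.
case: pickP => [j /eqP mji|/(_ i)]; last by rewrite eqxx.
have {j mji} -> : j = i.
  by apply/eqP/negPn/negP => /eqP ne; apply: (hdist j i).
apply/eqP/eqP; rewrite -eqz_nat -!modz_nat gez0_abs ?modz_ge0 -?lt0n //.
by rewrite modz_mod xE GRing.addrC modzMDl.
Qed.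

Theorem theorem1 (n : nat) (a : 'I_n -> int) (m : 'I_n -> nat)
    (hcov : covering_system a m)
    (hdist : distinct_moduli m)
    (hmin : smallest_modulus m 5) :
  (108 <= \max_(i < n) m i)%N.
Proof.
case: hcov => m_gt0 cov; case: hmin => _ m_ge5.
rewrite leqNgt; apply/negP => max_lt; apply: (@no_cover (residue a m)) => x.
have [i xi] := cov (Posz x); apply/hasP; exists (m i); last exact: residue_class.
by rewrite mem_iota m_ge5 (leq_ltn_trans (leq_bigmax i)).
Qed.
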